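(* Let $Q=(I,\Omega)$ be a finite quiver. For each $V\subseteq\mathbb{N}^I$ and $\alpha\in\mathbb{N}^I$ there exists a polynomial $M_{Q,\alpha,V}(t)\in\mathbb{Z}[t]$ such that, for any prime power $q$, $M_{Q,\alpha,V}(q)$ is equal to the number of isomorphism classes of representations of $Q$ over $\mathbb{F}_q$ of level at most $V$ and of dimension vector $\alpha$. Moreover, the following identity holds in $\mathbb{Q}(t)[[y_i]]_{i\in I}$: $$\mathrm{Exp}\Big(\sum_{\beta\in V}a_{Q,\beta}(t)y^\beta\Big)=\sum_{\alpha\in\mathbb{N}^I}M_{Q,\alpha,V}(t)y^\alpha.$$
   Context: For a finite-dimensional representation $X$ of $Q$ over a field $K$, let $\mathcal{H}_X\subseteq\mathbb{N}^I$ be the set of dimension vectors of the indecomposable direct summands of $X\otimes_K\overline K$ (Krull-Schmidt decomposition). $X$ is of level at most $V$ if $\mathcal{H}_X\subseteq V$. A representation $X$ over $K$ is absolutely indecomposable if $X\otimes_K\overline K$ is indecomposable. The Kac polynomial $a_{Q,\beta}(t)\in\mathbb{Z}[t]$ is the polynomial (which exists by a theorem of Kac) such that for every prime power $q$, $a_{Q,\beta}(q)$ is the number of isomorphism classes of absolutely indecomposable representations of $Q$ over $\mathbb{F}_q$ of dimension vector $\beta$ (so $a_{Q,0}=0$). Write $y^\beta=\prod_{i\in I}y_i^{\beta_i}$. On $R=\mathbb{Q}(t)[[y_i]]_{i\in I}$ the Adams operations are $\psi_d(f(t,y))=f(t^d,y^d)$, where $y^d=(y_i^d)_{i\in I}$.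 With $R^+\subseteq R$ the ideal generated by the $y_i$, the plethystic exponential $\mathrm{Exp}:R^+\to1+R^+$ is $\mathrm{Exp}(f)=\exp\big(\sum_{n\ge1}\psi_n(f)/n\big)$. *)

(* Defs.v *)
From HB Require Import structures.
From mathcomp Require Import all_boot all_order all_algebra all_field.
From mathcomp Require Import all_classical.

Set Implicit Arguments.
Unset Strict Implicit.
Unset Printing Implicit Defensive.

Import GRing.Theory.
Local Open Scope ring_scope.

(** * Quivers and representations *)

Record quiver := Quiver {
  vertex : finType;
  arrow : finType;
  src : arrow -> vertex;
  tgt : arrow -> vertex }.

Definition dimvec (Q : quiver) : Type := {ffun vertex Q -> nat}.

Section Representations.
Variables (Q : quiver) (K : fieldType).
Implicit Types d e : vertex Q -> nat.

(* The space at vertex i is K^(d i), seen as column vectors.  Dimension vectors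
   are plain functions here, so that [d i + e i] is reached by conversion in
   the block matrices of [dsum]; a [dimvec] is used through its coercion. *)
Definition rep d : Type :=
  {dffun forall h : arrow Q, 'M[K]_(d (tgt h), d (src h))}.

Definition hom d e (X : rep d) (Y : rep e)
    (f : forall i : vertex Q, 'M[K]_(e i, d i)) : Prop :=
  forall h : arrow Q, f (tgt h) *m X h = Y h *m f (src h).

Definition iso d e (X : rep d) (Y : rep e) : Prop :=
  exists f : forall i : vertex Q, 'M[K]_(e i, d i),
  exists g : forall i : vertex Q, 'M[K]_(d i, e i),
    [/\ hom X Y f, hom Y X g,
        forall i, g i *m f i = 1%:M & forall i, f i *m g i = 1%:M].

Definition dsum d e (X : rep d) (Y : rep e) : rep (fun i => d i + e i)%N :=
  [ffun h : arrow Q => block_mx (X h) 0 0 (Y h)].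

Definition indecomposable d (X : rep d) : Prop :=
  (exists i, d i <> 0%N) /\
  forall d1 d2 (X1 : rep d1) (X2 : rep d2), iso X (dsum X1 X2) ->
    (forall i, d1 i = 0%N) \/ (forall i, d2 i = 0%N).

Definition indec_summand_dims d (X : rep d) : set (dimvec Q) :=
  [set beta : dimvec Q | exists Y : rep beta, indecomposable Y /\
     exists d' (Z : rep d'), iso X (dsum Y Z)]%classic.

End Representations.

Definition base_change (Q : quiver) (K L : fieldType) (phi : {rmorphism K -> L})
    (d : vertex Q -> nat) (X : rep K d) : rep L d :=
  [ffun h : arrow Q => map_mx phi (X h)].

(** * Level and absolute indecomposability *)

Definition algclosure (K : countFieldType) : countClosedFieldType :=
  projT1 (countable_algebraic_closure K).

Definition to_algclosure (K : countFieldType) : {rmorphism K -> algclosure K} :=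
  sval (projT2 (countable_algebraic_closure K)).

Section Level.
Variables (Q : quiver) (K : countFieldType) (d : vertex Q -> nat).
Implicit Type X : rep K d.

Definition level_at_most (V : set (dimvec Q)) X : Prop :=
  (indec_summand_dims (base_change (to_algclosure K) X) `<=` V)%classic.

Definition abs_indecomposable X : Prop :=
  indecomposable (base_change (to_algclosure K) X).

End Level.

(** * Counting over finite fields *)

(* Number of isomorphism classes meeting P; P is isomorphism-invariant in all
   uses below. *)
Definition num_iso_classes (Q : quiver) (F : finFieldType)
    (d : vertex Q -> nat) (P : rep (Q := Q) F d -> Prop) : nat :=
  #|equivalence_partition (fun X Y : rep F d => `[< iso X Y >])
      (finset (fun X : rep F d => `[< P X >]))|.

(* Finite fields are taken up to isomorphism to be the F_q, q a prime power,
   with q = #|F|.  There are infinitely many such q, so this determines p;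
   that such a p exists is Kac's theorem. *)
Definition is_kac_polynomial (Q : quiver) (beta : dimvec Q) (p : {poly int}) :=
  forall F : finFieldType,
    p.[#|F|%:R] =
      (num_iso_classes (fun X : rep F beta => abs_indecomposable X))%:R.

(** * Power series over Q(t) and the plethystic exponential *)

Notation Qt := {fraction {poly rat}}.

Definition Qt_of_intpoly (p : {poly int}) : Qt :=
  tofrac (map_poly (intr : int -> rat) p).

(* f(t) |-> f(t^n), computed on a representative fraction (for n > 0 the
   denominator stays nonzero and the result is independent of the choice). *)
Definition Qt_adams (n : nat) (f : Qt) : Qt :=
  tofrac (\n_(repr f) \Po 'X^n) / tofrac (\d_(repr f) \Po 'X^n).

Section PowerSeries.
Variable I : finType.

(* Q(t)[[y_i]]_{i in I}: a series is its family of coefficients. *)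
Definition series : Type := {ffun I -> nat} -> Qt.
Implicit Types f g : series.

Definition series1 : series := fun alpha => ([forall i, alpha i == 0%N])%:R.

Definition series_mul f g : series := fun alpha =>
  \sum_(p \in [set p : {ffun I -> nat} * {ffun I -> nat} |
                 forall i, p.1 i + p.2 i = alpha i]%N%classic) f p.1 * g p.2.

Definition series_pow f (k : nat) : series := iter k (series_mul f) series1.

Definition adams (n : nat) f : series := fun alpha =>
  if [forall i, n %| alpha i]%N then Qt_adams n (f [ffun i => alpha i %/ n]%N)
  else 0.

(* The infinite sums below are coefficientwise; when f has no constant term,
   only finitely many terms contribute to each coefficient, which is where
   [\sum_(_ \in _)] is meaningful. *)
Definition series_exp f : series := fun alpha =>
  \sum_(k \in [set: nat]%classic) (k`!%:R)^-1 * series_pow f k alpha.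

Definition plethystic_Exp f : series :=
  series_exp (fun alpha =>
    \sum_(n \in [set n : nat | (0 < n)%N]%classic) (n%:R)^-1 * adams n f alpha).

End PowerSeries.

(* Main.v *)
(* Let K be an algebraic closure of a finite field F with q elements, and sigma
   the Frobenius x |-> x^q.  By Krull-Schmidt the isomorphism classes of
   representations over K are the finite multisets of classes of
   indecomposables, and sigma permutes the latter.  By Galois descent (Lang's
   theorem, and a Noether-Deuring argument for uniqueness) the representations
   over F of level at most V are the sigma-invariant multisets of
   indecomposables with dimension vectors in V, and the absolutely
   indecomposable representations over the field with q^n elements are the
   indecomposables fixed by sigma^n.

   Write M(alpha) for the number of such multisets of dimension alpha and |alpha|
   for the sum of the entries of alpha.  Counting in two ways, with weight |beta|,
   the pairs of a multiset A and a sequence y, sigma y, ..., sigma^(n-1) y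
   contained in A, with sigma^n y = y and y of dimension beta, gives
     |alpha| M(alpha) = sum over beta in V and n >= 1 of
                        |beta| a_beta(q^n) M(alpha - n beta).
   Applying the Euler operator y^alpha |-> |alpha| y^alpha to Exp gives the same
   recursion for its coefficients.  These are integral polynomials because
   subtracting a monomial t^k y^beta from f multiplies Exp(f) by
   1 - t^k y^beta. *)

From HB Require Import structures.
From mathcomp Require Import all_boot all_order all_algebra all_field.
From mathcomp Require Import finmap multiset.
From mathcomp Require Import all_classical.
(* After mathcomp, whose vector.v also defines hom. *)
Require Import Defs.
Import GRing.Theory.
Local Open Scope ring_scope.

Set Implicit Arguments.
Unset Strict Implicit.
Unset Printing Implicit Defensive.

(** * Homomorphisms, splittings and Fitting's lemma *)

(** Absolute indecomposability over a finite subfield E of K is defined through an algebraic closure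
    of E chosen independently of K. No isomorphism between the two closures is built: [split_local],
    by which every endomorphism is a scalar of E plus a nilpotent, characterises the property inside
    E, and both closures are compared with it. Passing from [split_local] back to the closure is
    where Engel's argument enters, because a combination over K of nilpotent matrices over E has to
    be shown nilpotent.

    The descent statements rest on a single dual-basis relation, [frob_dual_family]: it yields an
    element of trace 1, the spanning of homomorphisms over K by homomorphisms over L, and Lang's
    theorem. That K is algebraic over F enters only through the finiteness of Frobenius orbits of
    scalars.

    The weight in the double count gives a linear recursion, with no product over orbits and no
    Moebius inversion; dividing by |alpha| is harmless since the comparison takes place in
    characteristic zero. The polynomials M are read off Exp, and only then are their values at q
    identified with the counts. *)

Section Homs.
Variables (Q : quiver) (K : fieldType).
Implicit Types c d e : vertex Q -> nat.

Lemma hom_id d (X : rep K d) : hom X X (fun=> 1%:M).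
Proof. by move=> h; rewrite mul1mx mulmx1. Qed.

Lemma hom_comp c d e (X : rep K c) (Y : rep K d) (Z : rep K e) f g :
  hom X Y f -> hom Y Z g -> hom X Z (fun i => g i *m f i).
Proof. by move=> hf hg h; rewrite -mulmxA hf mulmxA hg mulmxA. Qed.

Lemma hom_add d e (X : rep K d) (Y : rep K e) f g :
  hom X Y f -> hom X Y g -> hom X Y (fun i => f i + g i).
Proof. by move=> hf hg h; rewrite mulmxDl mulmxDr hf hg. Qed.

Lemma hom_opp d e (X : rep K d) (Y : rep K e) f :
  hom X Y f -> hom X Y (fun i => - f i).
Proof. by move=> hf h; rewrite mulNmx mulmxN hf. Qed.

Lemma hom_sub d e (X : rep K d) (Y : rep K e) f g :
  hom X Y f -> hom X Y g -> hom X Y (fun i => f i - g i).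
Proof. by move=> hf hg; exact: hom_add hf (hom_opp hg). Qed.

Lemma hom_scale d e (X : rep K d) (Y : rep K e) a f :
  hom X Y f -> hom X Y (fun i => a *: f i).
Proof. by move=> hf h; rewrite -scalemxAl -scalemxAr hf. Qed.

Lemma hom_sum J d e (X : rep K d) (Y : rep K e) (s : seq J)
    (F : J -> forall i, 'M[K]_(e i, d i)) :
  (forall j, hom X Y (F j)) -> hom X Y (fun i => \sum_(j <- s) F j i).
Proof.
move=> hF h; rewrite mulmx_suml mulmx_sumr.
by apply: eq_bigr => j _; apply: hF.
Qed.

Lemma hom_exp d (X : rep K d) f N :
  hom X X f -> hom X X (fun i => f i ^+ N).
Proof.
move=> hf h; elim: N => [|N IHN]; first by rewrite !expr0 mulmx1 mul1mx.
by rewrite !exprS -mulmxE -mulmxA IHN mulmxA hf -mulmxA.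
Qed.

Lemma hom_inv d (X : rep K d) f :
  hom X X f -> (forall i, f i \in unitmx) -> hom X X (fun i => invmx (f i)).
Proof.
move=> hf uf h; apply: (can_inj (mulKmx (uf (tgt h)))).
by rewrite mulKVmx // mulmxA hf -mulmxA mulmxV // mulmx1.
Qed.

Lemma hom_col d e (X : rep K d) c (Y : rep K c) (Z : rep K e) f g :
  hom X Y f -> hom X Z g -> hom X (dsum Y Z) (fun i => col_mx (f i) (g i)).
Proof.
by move=> hf hg h; rewrite ffunE mul_col_mx mul_block_col !mul0mx add0r addr0 hf hg.
Qed.

Lemma hom_row d e (X : rep K d) c (Y : rep K c) (Z : rep K e) f g :
  hom Y X f -> hom Z X g -> hom (dsum Y Z) X (fun i => row_mx (f i) (g i)).
Proof.
by move=> hf hg h; rewrite ffunE mul_mx_row mul_row_block !mulmx0 add0r addr0 hf hg.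
Qed.

Lemma hom_usub d e (X : rep K d) c (Y : rep K c) (Z : rep K e) f :
  hom X (dsum Y Z) f ->
  hom X Y (fun i => usubmx (f i)) /\ hom X Z (fun i => dsubmx (f i)).
Proof.
move=> hf; have E h : col_mx (usubmx (f (tgt h)) *m X h)
   (dsubmx (f (tgt h)) *m X h) =
   col_mx (Y h *m usubmx (f (src h))) (Z h *m dsubmx (f (src h))).
  rewrite -mul_col_mx vsubmxK hf ffunE -{1}[f (src h)]vsubmxK.
  by rewrite mul_block_col !mul0mx addr0 add0r.
by split=> h; case: (eq_col_mx (E h)).
Qed.

Lemma hom_lsub d e (X : rep K d) c (Y : rep K c) (Z : rep K e) f :
  hom (dsum Y Z) X f ->
  hom Y X (fun i => lsubmx (f i)) /\ hom Z X (fun i => rsubmx (f i)).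
Proof.
move=> hf; have E h : row_mx (lsubmx (f (tgt h)) *m Y h)
   (rsubmx (f (tgt h)) *m Z h) =
   row_mx (X h *m lsubmx (f (src h))) (X h *m rsubmx (f (src h))).
  rewrite -mul_mx_row hsubmxK -hf ffunE -{3}[f (tgt h)]hsubmxK.
  by rewrite mul_row_block !mulmx0 addr0 add0r.
by split=> h; case: (eq_row_mx (E h)).
Qed.

Lemma iso_refl d (X : rep K d) : iso X X.
Proof.
exists (fun=> 1%:M), (fun=> 1%:M).
by split=> [||i|i]; rewrite ?mulmx1 //; apply: hom_id.
Qed.

Lemma iso_sym d e (X : rep K d) (Y : rep K e) : iso X Y -> iso Y X.
Proof. by case=> f [g [hf hg gf fg]]; exists g, f. Qed.

Lemma iso_trans c d e (X : rep K c) (Y : rep K d) (Z : rep K e) :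
  iso X Y -> iso Y Z -> iso X Z.
Proof.
case=> f [f' [hf hf' f'f ff']] [g [g' [hg hg' g'g gg']]].
exists (fun i => g i *m f i), (fun i => f' i *m g' i); split.
- exact: hom_comp hf hg.
- exact: hom_comp hg' hf'.
- by move=> i; rewrite -mulmxA (mulmxA (g' i)) g'g mul1mx.
- by move=> i; rewrite -mulmxA (mulmxA (f i)) ff' mul1mx.
Qed.

Lemma mulmx1_dim m n (A : 'M[K]_(m, n)) B : A *m B = 1%:M -> (m <= n)%N.
Proof.
move=> E; rewrite -(mxrank1 K m) -E.
exact: leq_trans (mxrankM_maxl _ _) (rank_leq_col _).
Qed.

Lemma iso_dim d e (X : rep K d) (Y : rep K e) : iso X Y -> d = e.
Proof.
case=> f [g [_ _ gf fg]]; apply/funext => i; apply/eqP.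
by rewrite eqn_leq (mulmx1_dim (gf i)) (mulmx1_dim (fg i)).
Qed.

(** Being a direct summand in retract form, with no complement to carry along; [summand_complement]
    recovers one. *)
Definition summand d e (X : rep K d) (Y : rep K e) :=
  exists f g, [/\ hom X Y f, hom Y X g & forall i, g i *m f i = 1%:M].

Lemma iso_summand d e (X : rep K d) (Y : rep K e) : iso X Y -> summand X Y.
Proof. by case=> f [g [hf hg gf _]]; exists f, g. Qed.

Lemma summand_trans c d e (X : rep K c) (Y : rep K d) (Z : rep K e) :
  summand X Y -> summand Y Z -> summand X Z.
Proof.
case=> f [f' [hf hf' f'f]] [g [g' [hg hg' g'g]]].
exists (fun i => g i *m f i), (fun i => f' i *m g' i); split.
- exact: hom_comp hf hg.
- exact: hom_comp hg' hf'.
- by move=> i; rewrite -mulmxA (mulmxA (g' i)) g'g mul1mx.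
Qed.

Lemma summand_dsuml d e (X : rep K d) (Y : rep K e) : summand X (dsum X Y).
Proof.
exists (fun=> col_mx 1%:M 0), (fun=> row_mx 1%:M 0); split.
- by apply: hom_col; [apply: hom_id | move=> h; rewrite mulmx0 mul0mx].
- by apply: hom_row; [apply: hom_id | move=> h; rewrite mulmx0 mul0mx].
- by move=> i; rewrite mul_row_col mulmx1 mul0mx addr0.
Qed.

Lemma iso_of_splitting c d e (X : rep K c) (A : rep K d) (B : rep K e) u v u' v' :
  hom A X u -> hom X A v -> hom B X u' -> hom X B v' ->
  (forall i, v i *m u i = 1%:M) -> (forall i, v' i *m u' i = 1%:M) ->
  (forall i, u i *m v i + u' i *m v' i = 1%:M) -> iso X (dsum A B).
Proof.
move=> hu hv hu' hv' vu v'u' E.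
(* Multiplying u v + u' v' = 1 by v on the left and u' on the right gives v u' + v u' = v u'. *)
have vu' i : v i *m u' i = 0.
  have := congr1 (fun M => v i *m M *m u' i) (E i).
  rewrite mulmx1 mulmxDr mulmxDl !mulmxA vu mul1mx -!mulmxA v'u' mulmx1.
  by move/eqP; rewrite -subr_eq0 addrK => /eqP.
have v'u i : v' i *m u i = 0.
  have := congr1 (fun M => v' i *m M *m u i) (E i).
  rewrite mulmx1 mulmxDr mulmxDl !mulmxA v'u' mul1mx -!mulmxA vu mulmx1.
  by move/eqP; rewrite -subr_eq0 addrK => /eqP.
exists (fun i => col_mx (v i) (v' i)), (fun i => row_mx (u i) (u' i)); split.
- exact: hom_col.
- exact: hom_row.
- by move=> i; rewrite mul_row_col E.
- by move=> i; rewrite mul_col_row vu vu' v'u v'u' -scalar_mx_block.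
Qed.

(** With a rank factorisation e = u v, cancelling u on the left and v on the right in u v u v = u v
    leaves v u = 1. The image carries the maps v X u. *)
Lemma split_idempotent d (X : rep K d) (e : forall i, 'M[K]_(d i)) :
  hom X X e -> (forall i, e i *m e i = e i) ->
  exists c (A : rep K c) u v, [/\ hom A X u, hom X A v,
    forall i, v i *m u i = 1%:M & forall i, u i *m v i = e i].
Proof.
move=> he ee.
have [r [u [v [uv vu]]]] : exists r (u : forall i, 'M[K]_(d i, r i))
    (v : forall i, 'M[K]_(r i, d i)),
    (forall i, u i *m v i = e i) /\ (forall i, v i *m u i = 1%:M).
  pose u i : 'M_(d i, \rank (e i)) := col_base (e i).
  pose v i : 'M_(\rank (e i), d i) := row_base (e i).
  have uv i : u i *m v i = e i by apply: mulmx_base.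
  have fu i : row_full (u i) by apply: col_base_full.
  have fv i : row_free (v i) by apply: row_base_free.
  clearbody u v; exists (fun i => \rank (e i)), u, v; split=> // i.
  apply: (row_free_inj (fv i)); apply: (row_full_inj (fu i)) => /=.
  by rewrite mul1mx !mulmxA uv -mulmxA uv ee.
exists r, [ffun h => v (tgt h) *m X h *m u (src h)], u, v.
split=> // h; rewrite ffunE.
  by rewrite !mulmxA uv he -!mulmxA -uv -mulmxA vu mulmx1.
by rewrite -!mulmxA uv -he -uv !mulmxA vu mul1mx.
Qed.

(** The complement is the image of the idempotent 1 - f g. *)
Lemma summand_complement d e (X : rep K d) (Y : rep K e) :
  summand X Y -> exists c (Z : rep K c), iso Y (dsum X Z).
Proof.
case=> f [g [hf hg gf]].
have [||c [Z [u [v [hu hv vu uv]]]]] :=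
  @split_idempotent _ Y (fun i => 1%:M - f i *m g i).
- by apply: hom_sub; [apply: hom_id | apply: hom_comp hg hf].
- move=> i; rewrite mulmxBr mulmx1 mulmxBl mul1mx -mulmxA (mulmxA (g i)).
  by rewrite gf mul1mx subrr subr0.
exists c, Z; apply: (iso_of_splitting hf hg hu hv gf vu) => i.
by rewrite uv addrC subrK.
Qed.

Lemma mx_dim0 m n (A B : 'M[K]_(m, n)) : m = 0%N -> A = B.
Proof. by move=> m0; apply/matrixP => i; have := ltn_ord i; rewrite {2}m0. Qed.

Lemma one_eq0_dim n : (1%:M : 'M[K]_n) = 0 -> n = 0%N.
Proof. by move=> E; rewrite -(mxrank1 K n) E mxrank0. Qed.

Lemma iso_dsum_zeror d e (X : rep K d) (Z : rep K e) :
  (forall i, e i = 0%N) -> iso (dsum X Z) X.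
Proof.
move=> e0; exists (fun=> row_mx 1%:M 0), (fun=> col_mx 1%:M 0); split.
- by apply: hom_row; [apply: hom_id | move=> h; rewrite mulmx0 mul0mx].
- by apply: hom_col; [apply: hom_id | move=> h; rewrite mulmx0 mul0mx].
- move=> i; rewrite mul_col_row mulmx1 mulmx0 mul0mx scalar_mx_block.
  by congr block_mx; apply: mx_dim0.
- by move=> i; rewrite mul_row_col mulmx1 mul0mx addr0.
Qed.

Lemma indec_idempotent d (X : rep K d) (e : forall i, 'M[K]_(d i)) :
  indecomposable X -> hom X X e -> (forall i, e i *m e i = e i) ->
  (forall i, e i = 0) \/ (forall i, e i = 1%:M).
Proof.
move=> [_ indX] he ee.
have [c [A [u [v [hu hv vu uv]]]]] := split_idempotent he ee.
have [||c' [B [u' [v' [hu' hv' v'u' u'v']]]]] :=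
  @split_idempotent _ X (fun i => 1%:M - e i).
- by apply: hom_sub he; apply: hom_id.
- by move=> i; rewrite mulmxBr mulmx1 mulmxBl mul1mx ee subrr subr0.
have isoX : iso X (dsum A B).
  apply: (iso_of_splitting hu hv hu' hv' vu v'u') => i.
  by rewrite uv u'v' addrC subrK.
case: (indX _ _ _ _ isoX) => d0; [left | right] => i.
  by rewrite -uv -(mul1mx (v i)) (mx_dim0 1%:M 0 (d0 i)) mul0mx mulmx0.
apply/esym/eqP; rewrite -subr_eq0 -u'v' -(mul1mx (v' i)).
by rewrite (mx_dim0 1%:M 0 (d0 i)) mul0mx mulmx0.
Qed.

Lemma mul_blocks1 m n p (f : 'M[K]_(m + n, p)) (g : 'M[K]_(p, m + n)) :
  f *m g = 1%:M -> [/\ usubmx f *m lsubmx g = 1%:M, usubmx f *m rsubmx g = 0,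
    dsubmx f *m lsubmx g = 0 & dsubmx f *m rsubmx g = 1%:M].
Proof.
by rewrite -{1}[f]vsubmxK -{1}[g]hsubmxK mul_col_row scalar_mx_block => /eq_block_mx.
Qed.

Lemma indec_of_idempotent d (X : rep K d) : (exists i, d i <> 0%N) ->
  (forall e : forall i, 'M[K]_(d i), hom X X e -> (forall i, e i *m e i = e i) ->
    (forall i, e i = 0) \/ (forall i, e i = 1%:M)) -> indecomposable X.
Proof.
move=> d0 idX; split=> // d1 d2 X1 X2 [f [g [hf hg gf fg]]].
have hl := (hom_usub hf).1; have hr := (hom_lsub hg).1.
have B i := mul_blocks1 (fg i).
have lr i : usubmx (f i) *m lsubmx (g i) = 1%:M by case: (B i).
have [||E|E] := idX (fun i => lsubmx (g i) *m usubmx (f i)).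
- exact: (hom_comp hl hr).
- by move=> i; rewrite mulmxA -(mulmxA (lsubmx _)) lr mulmx1.
- left=> i; apply: one_eq0_dim.
  by rewrite -(mulmx1 1%:M) -{1}lr -lr mulmxA -(mulmxA (usubmx _)) E mulmx0 mul0mx.
- right=> i; apply: one_eq0_dim.
  case: (B i) => _ _ lg rr.
  by rewrite -rr -(mulmx1 (dsubmx _)) -(E i) mulmxA lg !mul0mx.
Qed.

Lemma leq_sum_eq (I : finType) (a b : I -> nat) :
  (forall i, a i <= b i)%N -> (\sum_i b i <= \sum_i a i)%N -> a =1 b.
Proof.
move=> le_ab le_s i; apply/eqP; rewrite eqn_leq le_ab /=.
move: le_s; rewrite (bigD1 i) //= [X in (_ <= X)%N](bigD1 i) //= => le_s.
rewrite -(leq_add2r (\sum_(j | j != i) b j)%N).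
by apply: leq_trans le_s _; rewrite leq_add2l; apply: leq_sum.
Qed.

Lemma fitting d (X : rep K d) f : indecomposable X -> hom X X f ->
  (forall i, f i \in unitmx) \/ (exists N, forall i, f i ^+ N = 0).
Proof.
move=> indX hf.
(* One exponent has to serve all vertices, so the total rank is minimised. Exponents are N + 1
   because the last step extracts a factor [f i] from [g i]. *)
pose r N := (\sum_i \rank (f i ^+ N.+1))%N.
have [N minN] : exists N, forall M, (r N <= r M)%N.
  have exP : exists n, `[< exists N, r N = n >].
    by exists (r 0%N); apply/asboolP; exists 0%N.
  case: (ex_minnP exP) => n /asboolP[N <-] minN.
  by exists N => M; apply: minN; apply/asboolP; exists M.
pose g i := f i ^+ N.+1.
have hg : hom X X g by apply: hom_exp.
pose u i : 'M_(d i, \rank (g i)) := col_base (g i).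
pose v i : 'M_(\rank (g i), d i) := row_base (g i).
have uv i : u i *m v i = g i by apply: mulmx_base.
clearbody u v.
have rg i : \rank (g i *m g i) = \rank (g i).
  move: i; apply: leq_sum_eq => [i|]; first exact: mxrankM_maxl.
  have := minN (N.+1 + N)%N; rewrite /r.
  under [X in (_ <= X)%N -> _]eq_bigr => i _ do rewrite -addnS exprD -mulmxE.
  by [].
(* The square of g = u v is u (v u) v and has the rank of g, so v u has full rank. *)
have vu i : v i *m u i \in unitmx.
  have E : g i *m g i = u i *m (v i *m u i *m v i) by rewrite !mulmxA uv -mulmxA uv.
  rewrite -row_free_unit -row_leq_rank -{1}rg E.
  exact: leq_trans (mxrankM_maxr _ _) (mxrankM_maxl _ _).
(* [e] is the projection onto the image of g along its kernel, and [p] inverts g on that image. *)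
pose w i := invmx (v i *m u i).
pose e i := u i *m w i *m v i.
pose p i := u i *m w i *m w i *m v i.
have gp i : g i *m p i = e i.
  by rewrite -(uv i) /p /e -!mulmxA (mulmxA (v i)) (mulKVmx (vu i)).
have pg i : p i *m g i = e i.
  by rewrite -uv /p /e -!mulmxA (mulmxA (v i) (u i)) (mulKmx (vu i)).
have ge i : g i *m e i = g i.
  by rewrite -uv /e -!mulmxA (mulmxA (v i)) (mulKVmx (vu i)).
have eg i : e i *m g i = g i.
  by rewrite -uv /e -!mulmxA (mulmxA (v i) (u i)) (mulKmx (vu i)).
have ee i : e i *m e i = e i by rewrite -{2}gp mulmxA eg gp.
clearbody e p.
(* Both e X and X e equal e X e: write e as p g or g p, move g through X, and use e g = g e = g. *)
have he : hom X X e.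
  move=> h; transitivity (e (tgt h) *m X h *m e (src h)).
    rewrite -[in LHS]pg -[in RHS]pg -!mulmxA; congr (_ *m _).
    by rewrite mulmxA hg -mulmxA ge.
  rewrite -(gp (src h)) !mulmxA; congr (_ *m _).
  by rewrite -mulmxA -hg mulmxA eg.
case: (indec_idempotent indX he ee) => E; [right | left].
  by exists N.+1 => i; rewrite -/(g i) -ge E mulmx0.
move=> i; have := gp i; rewrite E /g exprS -mulmxE -mulmxA.
by case/mulmx1_unit.
Qed.

Lemma unitmx_sub_nilpotent n (A : 'M[K]_n) N :
  A ^+ N = 0 -> 1%:M - A \in unitmx.
Proof.
move=> A0; have := subrX1 A N; rewrite A0 sub0r => E.
suff /mulmx1_unit[] : (1%:M - A) *m (\sum_(i < N) A ^+ i) = 1%:M by [].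
by rewrite -opprB mulNmx mulmxE idmxE -E opprK.
Qed.

(** The endomorphism ring of an indecomposable is local: if h = (f + g)^-1 f is nilpotent, then 1 -
    h = (f + g)^-1 g is a unit. *)
Lemma local_add d (X : rep K d) f g : indecomposable X ->
  hom X X f -> hom X X g -> (forall i, f i + g i \in unitmx) ->
  (forall i, f i \in unitmx) \/ (forall i, g i \in unitmx).
Proof.
move=> indX hf hg ufg.
have hfg := hom_inv (hom_add hf hg) ufg.
case: (fitting indX (hom_comp hf hfg)) => [uf|[N nilf]]; [left | right] => i.
  by have := uf i; rewrite unitmx_mul => /andP[].
have := unitmx_sub_nilpotent (nilf i).
rewrite -{1}(mulVmx (ufg i)) -mulmxBr addrAC subrr add0r unitmx_mul.
by case/andP.
Qed.

Lemma local_sum d (X : rep K d) J (s : seq J) F : indecomposable X ->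
  (forall j, hom X X (F j)) -> (forall i, \sum_(j <- s) F j i \in unitmx) ->
  exists j, forall i, F j i \in unitmx.
Proof.
move=> indX hF; elim: s => [|j s IHs] us.
  case: (indX) => -[i di] _; have := us i.
  rewrite big_nil -(mul0mx _ (1%:M)) unitmx_mul => /andP[u0 _].
  case: di; apply: one_eq0_dim.
  by rewrite -(mulVmx u0) mulmx0.
case: (local_add indX (hF j) (hom_sum s hF)) => [i|uj|/IHs //].
  by have := us i; rewrite big_cons.
by exists j.
Qed.

Lemma summand_of_unit d e (X : rep K d) (Y : rep K e) f g :
  hom X Y f -> hom Y X g -> (forall i, g i *m f i \in unitmx) -> summand X Y.
Proof.
move=> hf hg u; exists f, (fun i => invmx (g i *m f i) *m g i); split=> //.
  exact: (hom_comp hg (hom_inv (hom_comp hf hg) u)).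
by move=> i; rewrite -mulmxA mulVmx.
Qed.

(** The identity of X is the sum of its composites through Y and through Z; by locality one of them
    is a unit. *)
Lemma summand_exchange c d e (X : rep K c) (Y : rep K d) (Z : rep K e) :
  indecomposable X -> summand X (dsum Y Z) -> summand X Y \/ summand X Z.
Proof.
move=> indX [f [g [hf hg gf]]].
have [hu hd] := hom_usub hf; have [hl hr] := hom_lsub hg.
case: (local_add indX (hom_comp hu hl) (hom_comp hd hr)) => [i|u|u].
- by rewrite -mul_row_col hsubmxK vsubmxK gf unitmx1.
- by left; apply: summand_of_unit hu hl u.
- by right; apply: summand_of_unit hd hr u.
Qed.

Lemma summand_indec d e (X : rep K d) (Y : rep K e) : (exists i, d i <> 0%N) ->
  indecomposable Y -> summand X Y -> iso X Y.
Proof.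
move=> [i di] indY /summand_complement[c [Z isoY]].
have [d0|c0] := indY.2 _ _ _ _ isoY; first by case: di.
exact/iso_sym/(iso_trans isoY)/iso_dsum_zeror.
Qed.

End Homs.

(** * Krull-Schmidt *)

Section KrullSchmidt.
Variables (Q : quiver) (K : fieldType).
Implicit Types c d e : vertex Q -> nat.

Lemma iso_dsum d1 d2 e1 e2 (X : rep K d1) (Y : rep K d2) (X' : rep K e1)
    (Y' : rep K e2) : iso X X' -> iso Y Y' -> iso (dsum X Y) (dsum X' Y').
Proof.
case=> f [f' [hf hf' f'f ff']] [g [g' [hg hg' g'g gg']]].
exists (fun i => block_mx (f i) 0 0 (g i)), (fun i => block_mx (f' i) 0 0 (g' i)).
split=> [h|h|i|i].
- by rewrite !ffunE !mulmx_block !mul0mx !mulmx0 !add0r !addr0 hf hg.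
- by rewrite !ffunE !mulmx_block !mul0mx !mulmx0 !add0r !addr0 hf' hg'.
- by rewrite mulmx_block !mul0mx !mulmx0 !add0r !addr0 f'f g'g -scalar_mx_block.
- by rewrite mulmx_block !mul0mx !mulmx0 !add0r !addr0 ff' gg' -scalar_mx_block.
Qed.

Lemma iso_dsumC d e (X : rep K d) (Y : rep K e) : iso (dsum X Y) (dsum Y X).
Proof.
exists (fun=> block_mx 0 1%:M 1%:M 0), (fun=> block_mx 0 1%:M 1%:M 0).
split=> [h|h|i|i]; rewrite ?ffunE !mulmx_block;
  rewrite !(mul0mx, mulmx0, mul1mx, mulmx1, add0r, addr0) //.
  by rewrite -scalar_mx_block.
by rewrite -scalar_mx_block.
Qed.

Lemma iso_dsumCA c d e (X : rep K c) (Y : rep K d) (Z : rep K e) :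
  iso (dsum X (dsum Y Z)) (dsum Y (dsum X Z)).
Proof.
have z c' d' (X' : rep K c') (Y' : rep K d') : hom X' Y' (fun=> 0).
  by move=> h; rewrite mulmx0 mul0mx.
apply: (@iso_of_splitting _ _ _ _ _ (dsum X (dsum Y Z)) Y (dsum X Z)
  (fun=> col_mx 0 (col_mx 1%:M 0)) (fun=> row_mx 0 (row_mx 1%:M 0))
  (fun=> row_mx (col_mx 1%:M 0) (col_mx 0 (col_mx 0 1%:M)))
  (fun=> col_mx (row_mx 1%:M 0) (row_mx 0 (row_mx 0 1%:M)))).
- by do 2!apply: hom_col => //; apply: hom_id.
- by do 2!apply: hom_row => //; apply: hom_id.
- by apply: hom_row; do ?apply: hom_col => //; apply: hom_id.
- by apply: hom_col; do ?apply: hom_row => //; apply: hom_id.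
- by move=> i; rewrite !mul_row_col !(mul0mx, mulmx0, mul1mx, add0r, addr0).
- move=> i; rewrite mul_col_row !mul_row_col.
  rewrite !(mul0mx, mulmx0, mul1mx, mulmx1, add0r, addr0).
  by rewrite -scalar_mx_block.
- move=> i; rewrite mul_row_col !mul_col_row.
  rewrite !(mul0mx, mulmx0, mul1mx, mulmx1, add0r, addr0) !add_block_mx.
  by rewrite !(add0r, addr0) add_block_mx !(add0r, addr0) -!scalar_mx_block.
Qed.

Lemma iso_dsumA c d e (X : rep K c) (Y : rep K d) (Z : rep K e) :
  iso (dsum (dsum X Y) Z) (dsum X (dsum Y Z)).
Proof.
apply: (iso_trans (iso_dsumC _ _)); apply: (iso_trans (iso_dsumCA _ _ _)).
by apply: iso_dsum; [apply: iso_refl | apply: iso_dsumC].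
Qed.

Lemma iso_zero d e (X : rep K d) (Y : rep K e) :
  (forall i, d i = 0%N) -> (forall i, e i = 0%N) -> iso X Y.
Proof.
move=> d0 e0; exists (fun=> 0), (fun=> 0).
by split=> [h|h|i|i]; apply: mx_dim0.
Qed.

(** Schur complement: for f = (a b; c d) with a invertible, d - c a^-1 b is inverse to the lower
    right block of g. *)
Lemma iso_schur c d e (Y : rep K c) (A : rep K d) (B : rep K e) f g :
  hom (dsum Y A) (dsum Y B) f -> hom (dsum Y B) (dsum Y A) g ->
  (forall i, g i *m f i = 1%:M) -> (forall i, f i *m g i = 1%:M) ->
  (forall i, ulsubmx (f i) \in unitmx) -> iso A B.
Proof.
move=> hf hg gf fg uf.
have [fu fd] := hom_usub hf; have [gu gd] := hom_usub hg.
have [ha hb] := hom_lsub fu; have [hc hd] := hom_lsub fd.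
have [hb' hd'] := ((hom_lsub gu).2, (hom_lsub gd).2).
exists (fun i => drsubmx (f i) - dlsubmx (f i) *m (invmx (ulsubmx (f i)) *m ursubmx (f i))).
exists (fun i => drsubmx (g i)).
have Egf i := gf i; have Efg i := fg i.
split=> //.
- apply: hom_sub => //; apply: hom_comp hc; apply: hom_comp hb _.
  exact: hom_inv.
- move=> i; have := gf i; rewrite -{1}[g i]submxK -{1}[f i]submxK mulmx_block.
  rewrite scalar_mx_block => /eq_block_mx[_ _ E1 E2].
  rewrite mulmxBr mulmxA.
  have -> : drsubmx (g i) *m dlsubmx (f i) = - (dlsubmx (g i) *m ulsubmx (f i)).
    by apply/eqP; rewrite -addr_eq0 addrC E1.
  by rewrite mulNmx opprK -mulmxA mulKVmx // addrC.
move=> i; have := fg i; rewrite -{1}[g i]submxK -{1}[f i]submxK mulmx_block.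
rewrite scalar_mx_block => /eq_block_mx[_ E1 _ E2].
rewrite mulmxBl -!mulmxA.
have -> : ursubmx (f i) *m drsubmx (g i) = - (ulsubmx (f i) *m ursubmx (g i)).
  by apply/eqP; rewrite -addr_eq0 addrC E1.
by rewrite mulmxN mulKmx // mulmxN opprK addrC.
Qed.

Lemma iso_cancel c d e (Y : rep K c) (A : rep K d) (B : rep K e) :
  indecomposable Y -> iso (dsum Y A) (dsum Y B) -> iso A B.
Proof.
move=> indY [f [g [hf hg gf fg]]].
have [fu fd] := hom_usub hf; have [gu gd] := hom_usub hg.
have [ha hb] := hom_lsub fu; have [hc hd] := hom_lsub fd.
have [ha' hb'] := hom_lsub gu.
have ua_iso : (forall i, ulsubmx (f i) \in unitmx) -> iso A B.
  exact: iso_schur hf hg gf fg.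
(* With f = (a b; c d) and g = (a' b'; c' d'), the relation g f = 1 gives a' a + b' c = 1 in the
   local ring End(Y). *)
case: (local_add indY (hom_comp ha ha') (hom_comp hc hb')) => [i|u|u].
- have := gf i; rewrite -{1}[g i]submxK -{1}[f i]submxK mulmx_block.
  by rewrite scalar_mx_block => /eq_block_mx[-> _ _ _]; rewrite unitmx1.
- by apply: ua_iso => i; have := u i; rewrite unitmx_mul => /andP[].
(* If b' c is a unit, write it as (a + b' c) + (-a). When a itself is not known to be a unit,
   composing f with the shear (1 b'; 0 1) turns the upper left block into the unit a + b' c. *)
have H := hom_add ha (hom_comp hc hb').
have [|ua|ua] := local_add indY H (hom_opp ha); last 1 first.
- apply: ua_iso => i; have := ua i; rewrite -scaleN1r unitmxZ //.
  exact: unitrN1.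
- by move=> i; rewrite addrAC subrr add0r; apply: u.
pose t (s : K) i : 'M[K]_(c i + e i) :=
  block_mx 1%:M (s *: rsubmx (usubmx (g i))) 0 1%:M.
have ht s : hom (dsum Y B) (dsum Y B) (t s).
  move=> h; rewrite ffunE !mulmx_block !(mul0mx, mulmx0, mul1mx, mulmx1, add0r, addr0).
  by rewrite (hom_scale s hb').
have tt i : t (-1) i *m t 1 i = 1%:M.
  rewrite mulmx_block !(mul0mx, mulmx0, mul1mx, mulmx1, add0r, addr0).
  by rewrite scaleN1r scale1r subrr -scalar_mx_block.
apply: (iso_schur (hom_comp hf (ht 1)) (hom_comp (ht (-1)) hg)) => i.
- by rewrite mulmxA -(mulmxA (g i)) tt mulmx1.
- by rewrite mulmxA -(mulmxA (t 1 i)) fg mulmx1; apply: mulmx1C.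
rewrite -[f i]submxK mulmx_block block_mxKul mul1mx scale1r.
exact: ua.
Qed.

Lemma dimvec_surj d : exists e : dimvec Q, d = e.
Proof. by exists [ffun i => d i]; apply/funext => i; rewrite ffunE. Qed.

Lemma indec_iso d e (X : rep K d) (Y : rep K e) :
  iso X Y -> indecomposable X -> indecomposable Y.
Proof.
move=> isoXY [[i di] indX]; have E := iso_dim isoXY.
split; first by exists i; rewrite -E.
by move=> d1 d2 X1 X2 isoY; apply: indX (iso_trans isoXY isoY).
Qed.

Definition obj : choiceType := {d : dimvec Q & rep K d}.

Definition orep (x : obj) : rep K (tag x) := tagged x.

Lemma obj_surj d (X : rep K d) : exists x : obj, iso X (orep x).
Proof.
have [e E] := dimvec_surj d; move: X; rewrite E => X.
by exists (@Tagged _ e (fun e : dimvec Q => rep K e) X); apply: iso_refl.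
Qed.

Fixpoint bdim (s : seq obj) : vertex Q -> nat :=
  if s is x :: s' then fun i => (tag x i + bdim s' i)%N else fun=> 0%N.

Fixpoint bsum (s : seq obj) : rep K (bdim s) :=
  if s is x :: s' then dsum (orep x) (bsum s') else [ffun h => 0].

Definition all_indec (s : seq obj) := forall x, x \in s -> indecomposable (orep x).

Lemma all_indec_cons x s :
  all_indec (x :: s) <-> indecomposable (orep x) /\ all_indec s.
Proof.
split=> [H|[Hx Hs] y].
  by split=> [|y ys]; apply: H; rewrite inE ?eqxx ?ys ?orbT.
by rewrite inE => /orP[/eqP->|/Hs].
Qed.

Lemma iso_bsum_cat s t : iso (bsum (s ++ t)) (dsum (bsum s) (bsum t)).
Proof.
elim: s => [|x s IHs] /=.
  apply: iso_trans (iso_dsumC _ _).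
  exact/iso_sym/iso_dsum_zeror.
apply: iso_trans (iso_sym (iso_dsumA _ _ _)).
by apply: iso_dsum IHs; apply: iso_refl.
Qed.

Lemma iso_bsum_rem x s : x \in s -> iso (bsum s) (dsum (orep x) (bsum (rem x s))).
Proof.
elim: s => //= y s IHs; rewrite inE.
have [-> _|] := eqVneq; first exact: iso_refl.
move=> _ /= /IHs H; apply: iso_trans (iso_dsumCA _ _ _).
exact: iso_dsum (iso_refl _) H.
Qed.

Lemma iso_bsum_perm s t : perm_eq s t -> iso (bsum s) (bsum t).
Proof.
elim: s t => [|x s IHs] t.
  by rewrite perm_sym => /perm_nilP->; apply: iso_refl.
move=> st; have xt : x \in t by rewrite -(perm_mem st) mem_head.
apply: iso_trans (iso_sym (iso_bsum_rem xt)); apply: iso_dsum (iso_refl _) _.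
by apply: IHs; rewrite -(perm_cons x) (perm_trans st) // perm_to_rem.
Qed.

Lemma summand_bsum c (X : rep K c) s : indecomposable X -> all_indec s ->
  summand X (bsum s) -> exists2 y, y \in s & iso X (orep y).
Proof.
move=> indX; elim: s => [|y s IHs] /=.
  move=> _ [f [g [_ _ gf]]]; case: indX => -[i ci] _; case: ci.
  by have := mulmx1_dim (gf i); rewrite leqn0 => /eqP.
move=> /all_indec_cons[indy inds] /(summand_exchange indX)[].
  by move/(summand_indec indX.1 indy) => iXy; exists y; rewrite ?mem_head.
by move/(IHs inds) => [z zs iXz]; exists z => //; rewrite inE zs orbT.
Qed.

Lemma exists_indec_sum d (X : rep K d) :
  exists s, all_indec s /\ iso X (bsum s).
Proof.
have [n] := ubnP (\sum_i d i)%N; elim: n d X => // n IHn d X le_dn.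
have [d0|dN0] := pselect (forall i, d i = 0%N).
  by exists [::]; split=> //; apply: iso_zero.
have [i di] : exists i, d i <> 0%N by apply/existsNP.
have [indX|] := pselect (indecomposable X).
  have [x Xx] := obj_surj X; exists [:: x]; split.
    by move=> y; rewrite inE => /eqP->; apply: indec_iso indX.
  apply: (iso_trans Xx); apply/iso_sym/iso_dsum_zeror => //.
move/not_andP => [|]; first by case; exists i.
move=> /existsNP[d1] /existsNP[d2] /existsNP[X1] /existsNP[X2].
move=> /not_implyP[isoX] /not_orP[/existsNP[i1 di1] /existsNP[i2 di2]].
have Ed := iso_dim isoX.
have Es : (\sum_i d i = \sum_i d1 i + \sum_i d2 i)%N by rewrite Ed big_split.
have [|s1 [ind1 iso1]] := IHn _ X1.
  rewrite -ltnS; apply: leq_trans le_dn; rewrite ltnS Es.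
  rewrite -{1}[(\sum_i d1 i)%N]addn0 ltn_add2l (bigD1 i2) //= addn_gt0.
  by rewrite lt0n; apply/orP; left; apply/eqP.
have [|s2 [ind2 iso2]] := IHn _ X2.
  rewrite -ltnS; apply: leq_trans le_dn; rewrite ltnS Es.
  rewrite -{1}[(\sum_i d2 i)%N]add0n ltn_add2r (bigD1 i1) //= addn_gt0.
  by rewrite lt0n; apply/orP; left; apply/eqP.
exists (s1 ++ s2); split.
  by move=> x; rewrite mem_cat => /orP[/ind1|/ind2].
apply: iso_trans (iso_sym (iso_bsum_cat _ _)).
exact: iso_trans isoX (iso_dsum iso1 iso2).
Qed.

Definition canon (x : obj) : obj :=
  choose (fun y : obj => `[< iso (orep x) (orep y) >]) x.

Lemma canonP x : iso (orep x) (orep (canon x)).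
Proof.
apply/asboolP; apply: (@chooseP _ (fun y : obj => `[< iso (orep x) (orep y) >])).
by apply/asboolP/iso_refl.
Qed.

Lemma eq_canon x y : iso (orep x) (orep y) -> canon x = canon y.
Proof.
move=> xy; rewrite /canon.
have E : (fun z : obj => `[< iso (orep x) (orep z) >]) =1
         (fun z : obj => `[< iso (orep y) (orep z) >]).
  move=> z; apply/asboolP/asboolP => [xz|]; last exact: iso_trans.
  exact: iso_trans (iso_sym xy) xz.
rewrite (eq_choose E); apply: choose_id; apply/asboolP => //.
  exact: iso_sym.
exact: iso_refl.
Qed.

(** A transversal of the isomorphism classes of indecomposables, cut out of a choice type so that
    finite multisets over it are available. *)
Definition indec_class : choiceType :=
  {x : obj | `[< canon x = x /\ indecomposable (orep x) >]}.

Implicit Types t : indec_class.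

Definition indec_rep t : rep K (tag (val t)) := orep (val t).

Lemma indec_classP t : indecomposable (indec_rep t).
Proof. by case: t => x hx; case: (asboolW hx). Qed.

Lemma indec_class_inj t t' : iso (indec_rep t) (indec_rep t') -> t = t'.
Proof.
case: t t' => [x /= hx] [y /= hy] xy; apply: val_inj => /=.
have [Ex _] := asboolW hx; have [Ey _] := asboolW hy.
by rewrite -Ex -[RHS]Ey; apply: eq_canon.
Qed.

Lemma indec_class_surj d (X : rep K d) :
  indecomposable X -> exists t, iso X (indec_rep t).
Proof.
move=> indX; have [x Xx] := obj_surj X.
have Xcx := iso_trans Xx (canonP x).
have h : `[< canon (canon x) = canon x /\ indecomposable (orep (canon x)) >].
  by apply/asboolP; split; [exact/esym/eq_canon/canonP | apply: indec_iso indX].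
by exists (exist _ (canon x) h).
Qed.

Definition csum (s : seq indec_class) := bsum (map val s).

Lemma all_indec_class (s : seq indec_class) : all_indec (map val s).
Proof. by move=> _ /mapP[t _ ->]; apply: indec_classP. Qed.

Lemma csum_exists d (X : rep K d) : exists s : seq indec_class, iso X (csum s).
Proof.
have [s [+ ]] := exists_indec_sum X; elim: s d X => [|x s IHs] d X.
  by exists [::].
move=> /all_indec_cons[indx inds] isoX.
have [t xt] := indec_class_surj indx.
have [s' ss'] := IHs _ (bsum s) inds (iso_refl _).
by exists (t :: s'); apply: iso_trans isoX (iso_dsum xt ss').
Qed.

(** Krull-Schmidt uniqueness: by exchange the head of [s] is isomorphic to a term of [t], hence
    equal to it in the transversal, and [iso_cancel] removes it from both sides. *)
Lemma csum_uniq (s t : seq indec_class) : iso (csum s) (csum t) -> perm_eq s t.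
Proof.
elim: s t => [|x s IHs] t st.
  case: t st => // x t /iso_dim/= E.
  case: (indec_classP x) => -[i xi] _; have := congr1 (@^~ i) E => /= /eqP.
  by rewrite eq_sym addn_eq0 => /andP[/eqP].
have : summand (indec_rep x) (csum t).
  exact: summand_trans (summand_dsuml _ _) (iso_summand st).
move/(summand_bsum (indec_classP x) (@all_indec_class t)) => [_ /mapP[y yt ->]].
move/indec_class_inj => E; rewrite -{y}E in yt.
rewrite perm_sym (perm_trans (perm_to_rem yt)) // perm_cons perm_sym.
apply: IHs; apply: (iso_cancel (indec_classP x)).
apply: iso_trans (st : iso (dsum (indec_rep x) (csum s)) _) _.
exact: iso_bsum_perm (perm_map _ (perm_to_rem yt)).
Qed.

(* The multiset of isomorphism classes of the indecomposable summands of X. *)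
Definition classes d (X : rep K d) : {mset indec_class}%mset :=
  seq_mset (projT1 (cid (csum_exists X))).

Lemma iso_classes d (X : rep K d) (s : seq indec_class) :
  iso X (csum s) <-> classes X = seq_mset s.
Proof.
rewrite /classes; case: cid => r /= Xr; split=> [Xs|/eq_seq_msetP rs].
  by apply/eq_seq_msetP; apply: csum_uniq; apply: iso_trans Xs; apply: iso_sym.
exact: iso_trans Xr (iso_bsum_perm (perm_map _ rs)).
Qed.

Lemma classes_csum s : classes (csum s) = seq_mset s.
Proof. exact/iso_classes/iso_refl. Qed.

Lemma iso_csum_classes d (X : rep K d) : iso X (csum (classes X)).
Proof. by apply/iso_classes; rewrite seq_mset_id. Qed.

Lemma eq_classes d e (X : rep K d) (Y : rep K e) : classes X = classes Y <-> iso X Y.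
Proof.
split=> [E|XY]; last first.
  by rewrite -[RHS]seq_mset_id; apply/iso_classes/(iso_trans XY)/iso_csum_classes.
apply: iso_trans (iso_csum_classes X) _; rewrite E.
exact/iso_sym/iso_csum_classes.
Qed.

Lemma classes_dsum d e (X : rep K d) (Y : rep K e) :
  classes (dsum X Y) = (classes X `+` classes Y)%mset.
Proof.
have -> : (classes X `+` classes Y)%mset = seq_mset (classes X ++ classes Y).
  apply/msetP => t; rewrite msetE2 mset_seqE count_cat.
  by rewrite !count_mem_mset.
apply/iso_classes; rewrite /csum map_cat.
apply: iso_trans (iso_sym (iso_bsum_cat _ _)).
by apply: iso_dsum; apply: iso_csum_classes.
Qed.

(** Read off the addition of multisets. [iso_descent] needs arbitrary Y, since an indecomposable
    over L may decompose over K. *)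
Lemma iso_cancel_dsum c d e (Y : rep K c) (A : rep K d) (B : rep K e) :
  iso (dsum Y A) (dsum Y B) -> iso A B.
Proof.
move/eq_classes; rewrite !classes_dsum => /msetP E; apply/eq_classes/msetP => t.
by have := E t; rewrite !msetE2 => /addnI.
Qed.

Lemma classes_indec t : classes (indec_rep t) = [mset t]%mset.
Proof.
rewrite (_ : [mset t]%mset = seq_mset [:: t]).
  by apply/iso_classes; apply/iso_sym/iso_dsum_zeror.
by apply/msetP => u; rewrite mset_seqE msetnE /= addn0 eq_sym; case: eqP.
Qed.

Lemma dim_csum (s : seq indec_class) i :
  bdim (map val s) i = (\sum_(t <- s) tag (val t) i)%N.
Proof. by elim: s => [|t s IHs] /=; rewrite ?big_nil // big_cons IHs. Qed.

Lemma dim_classes d (X : rep K d) i : d i = (\sum_(t <- classes X) tag (val t) i)%N.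
Proof. by rewrite {1}(iso_dim (iso_csum_classes X)) dim_csum. Qed.

Lemma indec_summand_dimsP d (X : rep K d) (beta : dimvec Q) :
  indec_summand_dims X beta <-> exists2 t, t \in classes X & tag (val t) = beta.
Proof.
split=> [[Y [indY [d' [Z XYZ]]]]|[t tX <-]].
  have [t Yt] := indec_class_surj indY; exists t.
    move/eq_classes: XYZ => ->; rewrite classes_dsum; move/eq_classes: Yt => ->.
    by rewrite classes_indec in_msetD in_mset1 eqxx.
  have E := iso_dim Yt.
  by apply/ffunP => i; rewrite -[LHS]/((fun_of_fin (tag (val t))) i) -E.
exists (indec_rep t); split; first exact: indec_classP.
exists (bdim (map val (rem t (classes X)))), (csum (rem t (classes X))).
apply: iso_trans (iso_csum_classes X) _.
exact: iso_bsum_perm (perm_map _ (perm_to_rem tX)).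
Qed.

Lemma indec_classes d (X : rep K d) :
  indecomposable X <-> exists t, classes X = [mset t]%mset.
Proof.
split=> [indX|[t E]].
  have [t Xt] := indec_class_surj indX; exists t.
  by rewrite -classes_indec; apply/eq_classes.
apply: indec_iso (indec_classP t); apply/iso_sym/eq_classes.
by rewrite E classes_indec.
Qed.

End KrullSchmidt.

(** * Frobenius and the finite subfields of an algebraic closure *)

Lemma card_finField_pnat (L : finFieldType) (K : fieldType) (psi : {rmorphism L -> K}) :
  [pchar K].-nat #|L|.
Proof.
have [p p_pr pL] := finPcharP L.
have pK : p \in [pchar K] := rmorph_pchar psi pL.
have -> : #|L| = (p ^ logn p #|L|)%N := card_pprimeChar pL.
by rewrite pnatX (eq_pnat _ (pcharf_eq pK)) pnat_id.
Qed.

(** Replacing u by v u multiplies the sum by v^k, and some v has v^k != 1 because there are at most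
    k roots of unity of order dividing k. *)
Lemma sum_expf_eq0 (E : finFieldType) k :
  (0 < k < #|E|.-1)%N -> \sum_(u : E | u != 0) u ^+ k = 0.
Proof.
case/andP=> k_gt0 ltk.
have [v v0 vk] : exists2 v : E, v != 0 & v ^+ k != 1.
  apply: contrapT => H.
  have Hall : all k.-unity_root (enum (predC1 (0 : E))).
    apply/allP => v; rewrite mem_enum !inE unity_rootE => v0.
    by apply/negPn/negP => vk; apply: H; exists v.
  have := max_unity_roots k_gt0 Hall (enum_uniq _).
  by rewrite -cardE cardC1 leqNgt ltk.
set S := \sum_(u | _) _.
have ES : S = v ^+ k * S.
  rewrite {1}/S (reindex_inj (mulfI v0)) /= mulr_sumr.
  under eq_bigl => u do rewrite mulf_eq0 negb_or v0 /=.
  by apply: eq_bigr => u _; rewrite exprMn.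
have /eqP : (v ^+ k - 1) * S = 0 by rewrite mulrBl mul1r -ES subrr.
by rewrite mulf_eq0 subr_eq0 (negPf vk) => /eqP.
Qed.

Lemma natr_card_finField (E : finFieldType) : #|E|%:R = 0 :> E.
Proof.
have [p p_pr pE] := finPcharP E.
have -> : #|E| = (p ^ logn p #|E|)%N := card_pprimeChar pE.
rewrite natrX (pcharf0 pE) expr0n; case: eqP => // l0.
have : #|E| = (p ^ logn p #|E|)%N := card_pprimeChar pE.
by rewrite l0; have := finNzRing_gt1 E; case: #|E| => [|[]].
Qed.

Section LocallyFinite.
Variables (L : finFieldType) (K : countClosedFieldType) (psi : {rmorphism L -> K}).
Local Notation q := #|L|.

Lemma card_gt1 : (1 < q)%N.
Proof. exact: finNzRing_gt1. Qed.

(** The embedding argument certifies that K has the characteristic of L; carrying it lets the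
    ring-morphism structure be attached to the power map. *)
Definition frob of {rmorphism L -> K} := fun x : K => x ^+ q.
Local Notation phi := (frob psi).

Fact frob_zmod_morphism : zmod_morphism phi.
Proof.
move=> x y; rewrite /frob; apply/eqP; rewrite eq_sym subr_eq.
by rewrite -(exprDn_pchar _ _ (card_finField_pnat psi)) subrK.
Qed.

Fact frob_monoid_morphism : monoid_morphism phi.
Proof. by split=> [|x y]; rewrite /frob ?expr1n ?exprMn. Qed.

HB.instance Definition _ := GRing.isZmodMorphism.Build K K phi frob_zmod_morphism.
HB.instance Definition _ := GRing.isMonoidMorphism.Build K K phi frob_monoid_morphism.

Lemma iter_frob n x : iter n phi x = x ^+ (q ^ n).
Proof. by elim: n => [|n IHn] //=; rewrite IHn /frob -exprM expnSr. Qed.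

Lemma frob_psi a : phi (psi a) = psi a.
Proof. by rewrite /frob -rmorphXn expf_card. Qed.

Lemma frob_fixed x : phi x = x -> exists a, x = psi a.
Proof.
move=> fx; have : (map_poly psi ('X^q - 'X)).[x] == 0.
  rewrite rmorphB /= map_polyXn map_polyX !hornerE.
  by rewrite -{2}fx subrr.
rewrite finField_genPoly rmorph_prod horner_prod => /prodf_eq0[a _].
rewrite /= rmorphB /= map_polyX map_polyC !hornerE subr_eq0 => /eqP.
by exists a.
Qed.

(* n.+1 rather than n, so that the degree over L is never 0. *)
Definition in_subfield_of (_ : {rmorphism L -> K}) n : {pred K} :=
  [pred x | x ^+ (q ^ n.+1) == x].
Local Notation in_subfield := (in_subfield_of psi).

Fact in_subfield_divring n : divring_closed (in_subfield n).
Proof.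
have pK : [pchar K].-nat (q ^ n.+1)%N by rewrite pnatX (card_finField_pnat psi).
split=> [|x y|x y]; rewrite !inE; first by rewrite expr1n.
  move=> /eqP Ex /eqP Ey; apply/eqP.
  by apply: (addIr y); rewrite subrK -{2}Ey -exprDn_pchar // subrK.
by move=> /eqP Ex /eqP Ey; rewrite expr_div_n Ex Ey.
Qed.
HB.instance Definition _ n :=
  GRing.isDivringClosed.Build K (in_subfield n) (in_subfield_divring n).

(** All finite extensions of L are realised inside the one field K, so that representations over any
    of them can be compared over K. *)
Record subfield n := Subfield { subfield_val : K; _ : in_subfield n subfield_val }.
HB.instance Definition _ n := [isSub for (@subfield_val n)].
HB.instance Definition _ n := [Countable of subfield n by <:].
HB.instance Definition _ n := [SubChoice_isSubIntegralDomain of subfield n by <:].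
HB.instance Definition _ n := [SubIntegralDomain_isSubField of subfield n by <:].

(** The derivative of X^N - X is -1, since N = 0 in K; hence its N roots are distinct. *)
Lemma subfield_roots n :
  {r : seq K | [/\ uniq r, size r = (q ^ n.+1)%N & r =i in_subfield n]}.
Proof.
set N := (q ^ n.+1)%N.
have N1 : (1 < N)%N by rewrite -(exp1n n.+1) ltn_exp2r // card_gt1.
have N0 : N%:R = 0 :> K.
  by rewrite natrX -(rmorph_nat psi) natr_card_finField rmorph0 expr0n.
pose p : {poly K} := 'X^N - 'X.
have szX : (size (- 'X : {poly K}) < size ('X^N : {poly K}))%N.
  by rewrite size_polyN size_polyX size_polyXn.
have [r Ep] := closed_field_poly_normal p; exists r.
have lp : lead_coef p = 1 by rewrite /p lead_coefDl ?lead_coefXn.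
rewrite lp scale1r in Ep; split.
- rewrite -separable_prod_XsubC -Ep unlock /p derivB derivXn derivX.
  rewrite -mulr_natl -polyC_natr N0 polyC0 mul0r sub0r -(scaleN1r 1).
  by rewrite coprimepZr ?coprimep1 ?oppr_eq0 ?oner_eq0.
- have := congr1 (fun p : {poly K} => size p) Ep.
  rewrite /p size_polyDl // size_polyXn size_prod_XsubC => -[<-].
  by [].
move=> x; rewrite -root_prod_XsubC -Ep rootE !hornerE subr_eq0.
by rewrite !inE.
Qed.

Lemma subfield_enumP n :
  Finite.axiom (pmap (insub : K -> option (subfield n)) (sval (subfield_roots n))).
Proof.
case: subfield_roots => r /= [ur _ memr] x.
by rewrite count_uniq_mem ?pmap_sub_uniq // mem_pmap_sub memr -topredE /= (valP x).
Qed.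
HB.instance Definition _ n := isFinite.Build (subfield n) (@subfield_enumP n).

Lemma card_subfield n : #|{: subfield n}| = (q ^ n.+1)%N.
Proof.
rewrite cardT enumT unlock /= size_pmap_sub; case: subfield_roots => r /= [_ <- memr].
by apply/eqP; rewrite -all_count; apply/allP => x; rewrite memr.
Qed.

Definition subfield_incl n : {rmorphism subfield n -> K} := val.
End LocallyFinite.

(** * Galois descent of homomorphisms *)

Section BaseChange.
Variables (Q : quiver) (K K' : fieldType) (f : {rmorphism K -> K'}).
Implicit Types d e : vertex Q -> nat.

Lemma hom_base_change d e (X : rep K d) (Y : rep K e) g : hom X Y g ->
  hom (base_change f X) (base_change f Y) (fun i => map_mx f (g i)).
Proof. by move=> hg h; rewrite !ffunE -!map_mxM hg. Qed.

Lemma iso_base_change d e (X : rep K d) (Y : rep K e) :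
  iso X Y -> iso (base_change f X) (base_change f Y).
Proof.
case=> g [g' [hg hg' g'g gg']].
exists (fun i => map_mx f (g i)), (fun i => map_mx f (g' i)); split.
- exact: hom_base_change.
- exact: hom_base_change.
- by move=> i; rewrite -map_mxM g'g map_mx1.
- by move=> i; rewrite -map_mxM gg' map_mx1.
Qed.

Lemma base_change_dsum d e (X : rep K d) (Y : rep K e) :
  base_change f (dsum X Y) = dsum (base_change f X) (base_change f Y).
Proof. by apply/ffunP => h; rewrite !ffunE map_block_mx !map_mx0. Qed.

Lemma indecomposable_base_change d (X : rep K d) :
  indecomposable (base_change f X) -> indecomposable X.
Proof.
case=> d0 indX; split=> // d1 d2 X1 X2 /iso_base_change.
by rewrite base_change_dsum => /indX.
Qed.

End BaseChange.

Section Descent.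
Variables (L : finFieldType) (K : countClosedFieldType) (psi : {rmorphism L -> K}).
Local Notation q := #|L|.
Local Notation phi := (frob psi).

Lemma iter_frobD n x y : iter n phi (x + y) = iter n phi x + iter n phi y.
Proof. by elim: n => //= n ->; rewrite rmorphD. Qed.

Lemma iter_frob0 n : iter n phi 0 = 0.
Proof. by elim: n => //= n ->; rewrite rmorph0. Qed.

Lemma iter_frobM n x y : iter n phi (x * y) = iter n phi x * iter n phi y.
Proof. by elim: n => //= n ->; rewrite rmorphM. Qed.

Lemma iter_frob_psi n a : iter n phi (psi a) = psi a.
Proof. by elim: n => //= n ->; rewrite frob_psi. Qed.

Definition trace m (x : K) := \sum_(j < m) iter j phi x.

Lemma trace_frob m x : iter m phi x = x -> phi (trace m x) = trace m x.
Proof.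
move=> mx; rewrite /trace rmorph_sum /=.
case: m mx => [|m] mx; first by rewrite !big_ord0.
rewrite big_ord_recr /= -iterS mx big_ord_recl /= addrC.
by congr (_ + _).
Qed.

Lemma traceD m x y : trace m (x + y) = trace m x + trace m y.
Proof. by rewrite /trace -big_split; apply: eq_bigr => j _; rewrite iter_frobD. Qed.

Lemma trace0 m : trace m 0 = 0.
Proof. by rewrite /trace big1 // => j _; rewrite iter_frob0. Qed.

Lemma trace_sum m (J : Type) (s : seq J) (F : J -> K) :
  trace m (\sum_(j <- s) F j) = \sum_(j <- s) trace m (F j).
Proof. by elim/big_rec2: _ => [|j x y _ <-]; rewrite ?trace0 ?traceD. Qed.

Lemma trace_psi m x a : trace m (x * psi a) = trace m x * psi a.
Proof.
rewrite /trace mulr_suml; apply: eq_bigr => j _.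
by rewrite iter_frobM iter_frob_psi.
Qed.

(* Orthogonality of the characters u |-> u^(q^j) of the multiplicative group of
   the field with q^m elements, written as a dual-basis relation. *)
Lemma frob_dual_family m : (0 < m)%N -> exists (J : finType) (u c : J -> K),
  (forall i, iter m phi (u i) = u i) /\
  forall j, (j < m)%N -> \sum_i c i * iter j phi (u i) = (j == 0%N)%:R.
Proof.
case: m => // n _; pose E : finFieldType := subfield psi n.
have cE : #|{: E}| = (q ^ n.+1)%N by rewrite card_subfield.
have [v vP] : exists v : {rmorphism E -> K}, forall x, iter n.+1 phi (v x) = v x.
  by exists (subfield_incl psi n) => x; rewrite iter_frob; apply/eqP/(valP x).
(* With c = -u^-1 the sum is minus the sum of x^(q^j - 1) over nonzero x: for j = 0 it is -(q^m - 1)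
   = 1, and for 0 < j < m it vanishes by [sum_expf_eq0]. The convention 0^-1 = 0 removes the term x
   = 0. *)
exists E, v, (fun x : E => - (v x)^-1); split=> // j ltj.
have -> : \sum_(x : E) - (v x)^-1 * iter j phi (v x) =
          - v (\sum_(x : E | x != 0) x ^+ (q ^ j).-1).
  rewrite rmorph_sum /= -sumrN [RHS]big_mkcond /=.
  apply: eq_bigr => x _; rewrite iter_frob.
  have [->|x0] := eqVneq x 0.
    by rewrite rmorph0 invr0 oppr0 mul0r.
  have e1 : (q ^ j = (q ^ j).-1.+1)%N by rewrite prednK ?expn_gt0 ?(ltnW (card_gt1 L)).
  rewrite rmorphXn {1}e1.
  by rewrite exprS mulNr mulrA mulVf ?mul1r // fmorph_eq0.
have [->|j0] := eqVneq j 0%N.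
  rewrite expn0 /= (eq_bigr (fun=> 1)) => [|x _]; last by rewrite expr0.
  rewrite sumr_const; have -> : #|[pred x : E | x != 0]| = #|E|.-1 by rewrite -(cardC1 (0 : E)).
  rewrite rmorph_nat; apply/eqP; rewrite eqr_oppLR -subr_eq0 opprK -(natrD _ _ 1) addn1.
  by rewrite prednK ?(ltnW (card_gt1 E)) // -(rmorph_nat v) natr_card_finField rmorph0.
rewrite sum_expf_eq0 ?rmorph0 ?oppr0 // cE.
have lt1 : (1 < q ^ j)%N by rewrite -(exp1n j) ltn_exp2r ?card_gt1 ?lt0n.
have lt2 : (q ^ j < q ^ n.+1)%N by rewrite ltn_exp2l ?card_gt1.
by case: (q ^ j)%N lt1 lt2 => [|[|a]] //= _; case: (q ^ n.+1)%N.
Qed.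

(** Summing the dual-basis relation over j shows that the traces of the u i combine to 1, so one of
    them is nonzero; it lies in L and can be scaled to 1. *)
Lemma trace_eq1 m : (0 < m)%N -> exists2 w, iter m phi w = w & trace m w = 1.
Proof.
move=> m0; have [J [u [c [mu dual]]]] := frob_dual_family m0.
have [i ti] : exists i, trace m (u i) != 0.
  apply: contrapT => H.
  have : \sum_i c i * trace m (u i) = 1.
    under eq_bigr => i _ do rewrite /trace mulr_sumr.
    rewrite exchange_big /=; under eq_bigr => j _ do rewrite dual //.
    case: m m0 => // m _ in dual mu H *.
    by rewrite big_ord_recl big1 ?addr0.
  rewrite big1 => [/esym/eqP|i _]; first by rewrite oner_eq0.
  have -> : trace m (u i) = 0 by apply/eqP/negPn/negP => ti; apply: H; exists i.
  by rewrite mulr0.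
have [a Ea] := frob_fixed (trace_frob (mu i)).
have a0 : a != 0 by move: ti; rewrite Ea fmorph_eq0.
exists (u i * psi a^-1); first by rewrite iter_frobM mu iter_frob_psi.
by rewrite trace_psi Ea -rmorphM mulfV ?rmorph1.
Qed.

(** The form in which algebraicity of K over L is used. *)
Hypothesis phi_periodic : forall x, exists2 m, (0 < m)%N & iter m phi x = x.

Lemma iter_mul (T : Type) (f : T -> T) m x k : iter m f x = x -> iter (k * m) f x = x.
Proof. by move=> mx; elim: k => // k IHk; rewrite mulSn iterD IHk. Qed.

Lemma common_period (J : finType) (F : J -> K) :
  exists2 m, (0 < m)%N & forall j, iter m phi (F j) = F j.
Proof.
suff H (s : seq J) : exists2 m, (0 < m)%N & forall j, j \in s -> iter m phi (F j) = F j.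
  have [m m0 Hm] := H (enum J); exists m => // j.
  by apply: Hm; rewrite mem_enum.
elim: s => [|j s [m m0 Hm]]; first by exists 1%N.
have [m' m'0 Hm'] := phi_periodic (F j).
exists (m * m')%N => [|i]; first by rewrite muln_gt0 m0.
rewrite inE => /orP[/eqP->|/Hm Ei]; first exact: iter_mul.
by rewrite mulnC iter_mul.
Qed.

(** The map x |-> tr(w x) with tr(w) = 1 is L-linear and restricts to the identity of L; t j is its
    value at e j. The length of the trace is a common period of the finitely many e j. *)
Lemma scalar_retract (J : finType) (e : J -> K) : exists t : J -> L,
  forall (a : J -> L) b, \sum_j e j * psi (a j) = psi b -> \sum_j t j * a j = b.
Proof.
have [m m0 em] := common_period e; have [w mw tw] := trace_eq1 m0.
have fix_e j : exists a, trace m (w * e j) = psi a.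
  by apply/frob_fixed/trace_frob; rewrite iter_frobM mw em.
exists (fun j => projT1 (cid (fix_e j))) => a b Eb; apply: (fmorph_inj psi).
rewrite rmorph_sum /=.
have -> : \sum_j psi (projT1 (cid (fix_e j)) * a j) = \sum_j trace m (w * (e j * psi (a j))).
  apply: eq_bigr => j _; case: cid => t /= Et.
  by rewrite rmorphM -Et mulrA trace_psi.
by rewrite -trace_sum -mulr_sumr Eb trace_psi tw mul1r.
Qed.

Lemma map_frob_fixed m n (A : 'M[K]_(m, n)) :
  map_mx phi A = A -> exists B, A = map_mx psi B.
Proof.
move=> /matrixP EA.
have fixA i j : exists a, A i j = psi a.
  by apply: frob_fixed; have := EA i j; rewrite mxE.
exists (\matrix_(i, j) projT1 (cid (fixA i j))).
by apply/matrixP => i j; rewrite !mxE; case: cid.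
Qed.

Lemma iter_map_mx n m p (A : 'M[K]_(m, p)) i j :
  iter n (map_mx phi) A i j = iter n phi (A i j).
Proof. by elim: n => //= n <-; rewrite mxE. Qed.

Section Hom.
Variable Q : quiver.
Implicit Types d e : vertex Q -> nat.

Lemma base_change_frob d (X : rep L d) :
  base_change phi (base_change psi X) = base_change psi X.
Proof.
by apply/ffunP => h; rewrite !ffunE; apply/matrixP => i j; rewrite !mxE; apply: frob_psi.
Qed.

(* The traces of u * f for u in a dual family are fixed by Frobenius, hence
   defined over L, and they span f. *)
Lemma hom_span d e (X : rep L d) (Y : rep L e) f :
  hom (base_change psi X) (base_change psi Y) f ->
  exists (J : finType) (c : J -> K) (g : J -> forall i, 'M[L]_(e i, d i)),
    (forall j, hom X Y (g j)) /\
    forall i, f i = \sum_j c j *: map_mx psi (g j i).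
Proof.
move=> hf.
have [m m0 Hm] := @common_period {i : vertex Q & ('I_(e i) * 'I_(d i))%type}
  (fun z => f (tag z) (tagged z).1 (tagged z).2).
have {}Hm i a b : iter m phi (f i a b) = f i a b.
  exact: (Hm (@Tagged _ i (fun i => ('I_(e i) * 'I_(d i))%type) (a, b))).
have [J [u [c [mu dual]]]] := frob_dual_family m0.
pose y j i := \sum_(k < m) iter k (map_mx phi) (u j *: f i).
have yE j i a b : y j i a b = trace m (u j * f i a b).
  by rewrite summxE; apply: eq_bigr => k _; rewrite iter_map_mx mxE.
have y_fix j i : exists B, y j i = map_mx psi B.
  apply: map_frob_fixed; apply/matrixP => a b; rewrite mxE yE.
  by apply: trace_frob; rewrite iter_frobM mu Hm.
have hy j : hom (base_change psi X) (base_change psi Y) (y j).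
  apply: (hom_sum (index_enum 'I_m)
    (F := fun k i => iter k (map_mx phi) (u j *: f i))) => k.
  elim: (nat_of_ord k) => [|n IHn] /=; first exact: hom_scale.
  by have := hom_base_change phi IHn; rewrite !base_change_frob.
exists J, c, (fun j i => projT1 (cid (y_fix j i))); split=> [j h|i].
  apply: (@map_mx_inj _ _ psi); rewrite !map_mxM.
  case: cid => /= B <-; case: cid => /= B' <-.
  by have := hy j h; rewrite !ffunE.
apply/matrixP => a b; rewrite summxE.
(* Expanding the traces and summing over j first, duality keeps only the power 0 of Frobenius, which
   returns the entry of f. *)
transitivity (\sum_j c j * trace m (u j * f i a b)); last first.
  by apply: eq_bigr => j _; case: cid => /= B EB; rewrite -EB mxE yE.
under eq_bigr => j _ do rewrite /trace mulr_sumr.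
rewrite exchange_big /=.
under eq_bigr => k _ do
  (under eq_bigr => j _ do rewrite iter_frobM mulrA; rewrite -mulr_suml dual //).
case: m m0 {y yE y_fix hy mu dual Hm} => // m _.
by rewrite big_ord_recl big1 ?mul1r ?addr0 // => k _; rewrite mul0r.
Qed.

End Hom.

End Descent.

(** * Descent of representations *)

Section Lang.
Variables (L : finFieldType) (K : countClosedFieldType) (psi : {rmorphism L -> K}).
Local Notation q := #|L|.
Local Notation phi := (frob psi).
Hypothesis phi_periodic : forall x, exists2 m, (0 < m)%N & iter m phi x = x.

Section Twist.
Variables (n : nat) (a : 'M[K]_n).
Hypothesis ua : a \in unitmx.

Let twist (A : 'M[K]_n) := map_mx phi A *m a.

(* The twist permutes the finite set of matrices over a finite subfield
   containing the entries of a. *)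
Lemma twist_periodic : exists2 m, (0 < m)%N & iter m twist 1%:M = 1%:M.
Proof.
have [[|m0] // _ Hm] := common_period phi_periodic (fun z : 'I_n * 'I_n => a z.1 z.2).
pose E : finFieldType := subfield psi m0.
pose v : {rmorphism E -> K} := subfield_incl psi m0.
have [a0 Ea] : exists a0, a = map_mx v a0.
  apply: map_frob_fixed; apply/matrixP => i j; rewrite mxE /= /frob.
  by rewrite card_subfield -(iter_frob psi) (Hm (i, j)).
clearbody v.
pose f (B : 'M[E]_n) := map_mx (fun x => x ^+ q) B *m a0.
have fE B : map_mx v (f B) = twist (map_mx v B).
  rewrite /f /twist map_mxM -Ea; congr (_ *m _); apply/matrixP => i j.
  by rewrite !mxE rmorphXn.
have f_inj : injective f.
  have ua0 : a0 \in unitmx by rewrite -(map_unitmx v) -Ea.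
  move=> B C /(can_inj (mulmxK ua0))/matrixP EBC; apply/matrixP => i j.
  have := EBC i j; rewrite !mxE => /(congr1 v); rewrite !rmorphXn.
  by move/(fmorph_inj phi)/fmorph_inj.
exists (fingraph.order f 1%:M); first exact: order_gt0.
have iterE j : map_mx v (iter j f 1%:M) = iter j twist 1%:M.
  by elim: j => [|j IHj]; [rewrite map_mx1 | rewrite !iterS fE IHj].
by rewrite -iterE iter_order // map_mx1.
Qed.

(* Lang's theorem for GL_n. *)
Lemma lang : exists2 h, h \in unitmx & map_mx phi h *m a = h.
Proof.
have [m m0 Nm] := twist_periodic.
have [J [u [c [mu dual]]]] := frob_dual_family psi m0.
pose N j := iter j twist 1%:M.
(* The twist is Frobenius-semilinear, so [y i] is the sum over a full period of the iterated twists
   of the scalar matrix u i; it is therefore fixed. *)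
pose y i := \sum_(j < m) iter j phi (u i) *: N j.
have y_fix i : map_mx phi (y i) *m a = y i.
  rewrite map_mx_sum mulmx_suml.
  have E j : map_mx phi (iter j phi (u i) *: N j) *m a =
    iter j.+1 phi (u i) *: N j.+1 by rewrite map_mxZ -scalemxAl.
  under eq_bigr => j _ do rewrite E.
  rewrite /y; case: m m0 Nm mu {y dual} => // m _ Nm mu.
  rewrite big_ord_recr big_ord_recl /= addrC; congr (_ + _).
  by rewrite -!iterS mu /N Nm.
have sum_y : \sum_i c i *: y i = 1%:M.
  under eq_bigr => i _ do rewrite scaler_sumr.
  rewrite exchange_big /=.
  under eq_bigr => j _ do
    (under eq_bigr => i _ do rewrite scalerA; rewrite -scaler_suml dual //).
  case: m m0 {Nm mu dual y y_fix} => // m _.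
  by rewrite big_ord_recl big1 ?scale1r ?addr0 // => k _; rewrite scale0r.
(* Each [y i] is fixed but may be singular. Together their rows span, since a combination of the
   [y i] is 1; the twist acts row by row, so n independent rows form a fixed invertible matrix. *)
pose I := (J * 'I_n)%type.
pose Y : 'M_(#|{: I}|, n) := \matrix_p row (enum_val p).2 (y (enum_val p).1).
have Y_fix : map_mx phi Y *m a = Y.
  apply/row_matrixP => p; rewrite row_mul -map_row rowK map_row -row_mul.
  by rewrite y_fix.
have fullY : row_full Y.
  rewrite -sub1mx -sum_y; apply: summx_sub => i _; apply: scalemx_sub.
  apply/row_subP => j; have <- : row (enum_rank (i, j)) Y = row j (y i).
    by rewrite rowK enum_rankK.
  exact: row_sub.
exists (rowsub (fullrankfun fullY) Y); first exact: fullrowsub_unit.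
by rewrite map_mxsub mul_rowsub_mx Y_fix.
Qed.

End Twist.

Variable Q : quiver.
Implicit Types d e : vertex Q -> nat.

(** Lang's theorem applied to g^-1 at each vertex gives h with phi(h) = h g. Transporting X along h
    absorbs g, so the resulting matrices are fixed by Frobenius. *)
Lemma rep_descent d (X : rep K d) : iso (base_change phi X) X ->
  exists X0 : rep L d, iso X (base_change psi X0).
Proof.
case=> g [g' [hg hg' g'g gg']].
have ug i : g' i \in unitmx by case: (mulmx1_unit (gg' i)).
pose h i := projT1 (cid2 (lang (ug i))).
have [uh hE] : (forall i, h i \in unitmx) /\
    (forall i, map_mx phi (h i) *m g' i = h i).
  by split=> i; rewrite /h; case: cid2.
clearbody h; have {}hE i : map_mx phi (h i) = h i *m g i.
  by rewrite -{2}hE -mulmxA g'g mulmx1.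
pose X' : rep K d := [ffun k => h (tgt k) *m X k *m invmx (h (src k))].
have fixX' k : exists B, X' k = map_mx psi B.
  apply: map_frob_fixed; rewrite ffunE !map_mxM map_invmx !hE.
  have := hg k; rewrite ffunE => Ek.
  have inv_hg : g (src k) *m invmx (h (src k) *m g (src k)) = invmx (h (src k)).
    rewrite -[LHS](mulKmx (uh (src k))) (mulmxA (h _) (g _)) mulmxV ?mulmx1 //.
    by rewrite unitmx_mul uh; case: (mulmx1_unit (gg' (src k))).
  by rewrite -!mulmxA (mulmxA (g _)) Ek -!mulmxA inv_hg.
exists [ffun k => projT1 (cid (fixX' k))].
exists h, (fun i => invmx (h i)); split=> [k|k|i|i]; rewrite ?mulmxV ?mulVmx //.
  by rewrite !ffunE; case: cid => /= B <-; rewrite ffunE mulmxKV.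
by rewrite !ffunE; case: cid => /= B <-; rewrite ffunE !mulmxA mulVmx // mul1mx.
Qed.

(* Writing the identity of X as a sum of scalar multiples of composites G * F
   defined over L, an L-linear retraction K -> L makes it a sum over L, and the
   endomorphism ring of X is local. *)
Lemma summand_descent d e (X : rep L d) (Y : rep L e) : indecomposable X ->
  summand (base_change psi X) (base_change psi Y) -> summand X Y.
Proof.
move=> indX [f [g [hf hg gf]]].
have [J [c [F [hF Ef]]]] := hom_span phi_periodic hf.
have [J' [c' [G [hG Eg]]]] := hom_span phi_periodic hg.
have [t Ht] := scalar_retract phi_periodic (fun z : J' * J => c' z.1 * c z.2).
have E i : \sum_z t z *: (G z.1 i *m F z.2 i) = 1%:M.
  apply/matrixP => x y; rewrite summxE.
  under eq_bigr => z _ do rewrite mxE.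
  apply: Ht; rewrite -[RHS](_ : (1%:M : 'M[K]_(d i)) x y = _); last by rewrite !mxE rmorph_nat.
  rewrite -gf Ef Eg mulmx_suml summxE.
  under [RHS]eq_bigr => j _ do rewrite mulmx_sumr summxE.
  rewrite pair_bigA /=; apply: eq_bigr => -[j' j] _ /=.
  by rewrite -scalemxAl -scalemxAr scalerA -map_mxM !mxE.
have [|i|[j' j] u] := @local_sum _ _ _ X _ (index_enum (J' * J)%type)
  (fun z i => t z *: (G z.1 i *m F z.2 i)) indX.
- by move=> z; apply: hom_scale; exact: (hom_comp (hF z.2) (hG z.1)).
- by rewrite (E i) unitmx1.
apply: (summand_of_unit (hF j) (hG j')) => i.
(* If the coefficient is 0, then 0 is a unit at vertex i, which forces dimension 0 there; any matrix
   of that size is invertible. *)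
have := u i; have [->|t0] := eqVneq (t (j', j)) 0.
  rewrite scale0r => u0; rewrite (mx_dim0 (_ *m _) 0) //.
  by apply: (@one_eq0_dim L); rewrite -(mulVmx u0) mulmx0.
by rewrite unitmxZ ?unitfE.
Qed.

(** Noether-Deuring: an indecomposable summand x of X over L is a summand of Y over K, hence over L
    by [summand_descent]. Its extension is cancelled over K and the complements are treated by
    induction on total dimension. *)
Lemma iso_descent d e (X : rep L d) (Y : rep L e) :
  iso (base_change psi X) (base_change psi Y) -> iso X Y.
Proof.
have [n] := ubnP (\sum_i d i)%N; elim: n d X e Y => // n IHn d X e Y le_dn isoXY.
have [[|x s] [/= inds isoX]] := exists_indec_sum X.
  by apply: iso_zero => i; rewrite -?(iso_dim isoXY) (iso_dim isoX).
have indx : indecomposable (orep x) by apply: inds; rewrite mem_head.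
have [c [W isoY]] : exists c (W : rep L c), iso Y (dsum (orep x) W).
  apply/summand_complement/(summand_descent indx)/(summand_trans _ (iso_summand isoXY)).
  apply: summand_trans (iso_summand (iso_base_change psi (iso_sym isoX))).
  by rewrite base_change_dsum; apply: summand_dsuml.
apply: (iso_trans isoX (iso_trans _ (iso_sym isoY))).
apply: iso_dsum (iso_refl _) _; apply: IHn; last first.
  apply: (@iso_cancel_dsum _ _ _ _ _ (base_change psi (orep x))).
  rewrite -!base_change_dsum; apply: iso_trans (iso_base_change psi isoY).
  exact: iso_trans (iso_base_change psi (iso_sym isoX)) isoXY.
rewrite -ltnS; apply: leq_trans le_dn; rewrite ltnS (iso_dim isoX) big_split /=.
case: indx => -[i xi] _; rewrite -{1}[(\sum_i bdim s i)%N]add0n ltn_add2r.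
by rewrite (bigD1 i) //= addn_gt0 lt0n; apply/orP; left; apply/eqP.
Qed.

End Lang.

(** * Absolute indecomposability over finite fields *)

Section Engel.
Variables (F : finFieldType) (n : nat) (P : 'M[F]_n -> Prop).
Hypothesis P0 : P 0.
Hypothesis PD : forall A B, P A -> P B -> P (A + B).
Hypothesis PZ : forall a A, P A -> P (a *: A).
Hypothesis PM : forall A B, P A -> P B -> P (A *m B).
Hypothesis Pnil : forall A, P A -> exists N, A ^+ N = 0.

Let stable (U : 'M[F]_n) := forall A, P A -> (U *m A <= U)%MS.

(* Engel's argument: U' is minimal among the stable subspaces strictly
   containing U. *)
Lemma nil_algebra_step (U : 'M[F]_n) : stable U -> (\rank U < n)%N ->
  exists U' : 'M[F]_n, [/\ (U <= U')%MS, (\rank U < \rank U')%N &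
    forall A, P A -> (U' *m A <= U)%MS].
Proof.
move=> stU ltU.
have exW : exists r, `[< exists W : 'M[F]_n,
    [/\ (U <= W)%MS, (\rank U < \rank W)%N, stable W & \rank W = r] >].
  exists n; apply/asboolP; exists 1%:M; rewrite mxrank1; split=> //.
    exact: submx1.
  by move=> A _; apply: submx1.
case: (ex_minnP exW) => r /asboolP[W [UW rUW stW rW]] minW.
exists W; split=> // A0 PA0; apply: contrapT => /negP/row_subPn[k].
rewrite row_mul; set w := row k W => wA0.
have wW : (w <= W)%MS by apply: row_sub.
(* U + w P is stable, contained in W and larger than U, so it equals W by minimality. *)
pose S := (\sum_(A : 'M[F]_n | `[< P A >]) <<w *m A>>)%MS.
pose W' := (U + S)%MS.
have wS A : P A -> (w *m A <= W')%MS.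
  move=> PA; apply: submx_trans (addsmxSr U S).
  by apply: (sumsmx_sup A); [apply/asboolP | rewrite genmxE].
have W'W : (W' <= W)%MS.
  rewrite addsmx_sub UW; apply/sumsmx_subP => A /asboolP PA.
  rewrite genmxE; exact: submx_trans (submxMr _ wW) (stW _ PA).
have stW' : stable W'.
  move=> B PB; rewrite addsmxMr addsmx_sub (submx_trans (stU _ PB)) ?addsmxSl //=.
  rewrite sumsmxMr; apply/sumsmx_subP => A /asboolP PA.
  rewrite (eqmxMr B (genmxE _)) -mulmxA; exact/wS/PM.
have rUW' : (\rank U < \rank W')%N.
  have : (U < W')%MS.
    rewrite ltmxE addsmxSl /=; apply: contra wA0; apply: submx_trans.
    exact: wS.
  by rewrite ltmxErank => /andP[].
have WW' : (W <= W')%MS.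
  rewrite -(mxrank_leqif_sup W'W) eqn_leq mxrankS // rW.
  by apply: minW; apply/asboolP; exists W'; split=> //; apply: addsmxSl.
(* Thus w itself lies in U + w P, and the linear space P provides a single A with w = w A modulo
   U. *)
have [A [PA uA]] : exists A, P A /\ (w - w *m A <= U)%MS.
  have /sub_addsmxP[[u1 u2] /= Ew] := submx_trans wW WW'.
  have /sub_sumsmxP[c Ec] := submxMl u2 S.
  have HA A : exists a, c A *m <<w *m A>>%MS = a *: (w *m A).
    apply/sub_rVP; rewrite -(genmxE (w *m A)); exact: submxMl.
  exists (\sum_(A : 'M[F]_n | `[< P A >]) projT1 (cid (HA A)) *: A); split.
    elim/big_rec: _ => // A B /asboolP PA PB.
    by apply: PD => //; apply: PZ.
  have -> : w *m (\sum_(A : 'M[F]_n | `[< P A >]) projT1 (cid (HA A)) *: A) = u2 *m S.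
    rewrite Ec mulmx_sumr; apply: eq_bigr => A _; rewrite -scalemxAr.
    by case: cid => /= a ->.
  by rewrite {1}Ew addrK submxMl.
(* 1 - A is invertible and maps U onto U, so w (1 - A) in U forces w in U; stability of U then
   contradicts the choice of w. *)
have [N A_nil] := Pnil PA; have u1A := unitmx_sub_nilpotent A_nil.
have invU : (U <= U *m (1%:M - A))%MS.
  have le : (U *m (1%:M - A) <= U)%MS.
    by rewrite mulmxBr mulmx1 addmx_sub // eqmx_opp stU.
  by rewrite -(mxrank_leqif_sup le) mxrankMfree // row_free_unit.
case/negP: wA0; apply: submx_trans (stU _ PA0); apply: submxMr.
rewrite -(mulmxK u1A w) -[X in (_ <= X)%MS](mulmxK u1A U).
apply: submxMr; apply: submx_trans invU.
by rewrite mulmxBr mulmx1.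
Qed.

(** Nilpotency of the terms alone does not pass to a combination. The steps of [nil_algebra_step]
    build a flag over F along which all the nu j move one step down, and this property is linear, so
    it survives extension to K. *)
Lemma nil_algebra_base_change (K : fieldType) (psi : {rmorphism F -> K})
    (J : finType) (c : J -> K) (nu : J -> 'M[F]_n) :
  (forall j, P (nu j)) ->
  exists N, (\sum_j c j *: map_mx psi (nu j)) ^+ N = 0.
Proof.
move=> Pnu; set M := \sum_j _.
suff H (U : 'M[F]_n) : stable U -> exists N, (M ^+ N <= map_mx psi U)%MS.
  have [|N] := H 0; first by move=> A _; rewrite mul0mx.
  by rewrite map_mx0 submx0 => /eqP; exists N.
have [r] := ubnP (n - \rank U)%N; elim: r U => // r IHr U le_r stU.
have [geU|ltU] := leqP n (\rank U).
  by exists 0%N; apply: submx_full; rewrite -col_leq_rank mxrank_map.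
have [U' [UU' ltUU' stU']] := nil_algebra_step stU ltU.
have [||N MN] := IHr U'.
- by rewrite -ltnS; apply: leq_trans le_r; rewrite ltnS; apply: ltn_sub2l.
- by move=> A PA; apply: submx_trans (stU' _ PA) UU'.
exists N.+1; rewrite exprSr -mulmxE; apply: (submx_trans (submxMr M MN)).
rewrite mulmx_sumr; apply: summx_sub => j _.
by rewrite -scalemxAr -map_mxM; apply/scalemx_sub; rewrite map_submx stU'.
Qed.

End Engel.

Lemma expmxZ (R : comPzRingType) n (c : R) (A : 'M[R]_n) N :
  (c *: A) ^+ N = c ^+ N *: A ^+ N.
Proof.
elim: N => [|N IHN]; first by rewrite !expr0 scale1r.
by rewrite !exprS IHN -!mulmxE -scalemxAl -scalemxAr scalerA.
Qed.

Lemma map_mx_exp (R S : pzRingType) (f : {rmorphism R -> S}) n (A : 'M[R]_n) N :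
  map_mx f A ^+ N = map_mx f (A ^+ N).
Proof.
elim: N => [|N IHN]; first by rewrite !expr0 -!idmxE map_mx1.
by rewrite !exprS IHN -!mulmxE map_mxM.
Qed.

Lemma unitmx_exp (R : comUnitRingType) n (A : 'M[R]_n) N :
  A \in unitmx -> A ^+ N \in unitmx.
Proof.
move=> uA; elim: N => [|N IHN]; first by rewrite expr0 -idmxE unitmx1.
by rewrite exprS -mulmxE unitmx_mul uA.
Qed.

Lemma unitmx0_dim (K : fieldType) n : (0 : 'M[K]_n) \in unitmx -> n = 0%N.
Proof. by move=> u0; apply: (@one_eq0_dim K); rewrite -(mulVmx u0) mulmx0. Qed.

Lemma mulmx_exp_eigen (K : fieldType) n (B : 'M[K]_n) (v : 'rV[K]_n) c N :
  v *m B = c *: v -> v *m B ^+ N = c ^+ N *: v.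
Proof.
move=> vB; elim: N => [|N IHN]; first by rewrite !expr0 -idmxE mulmx1 scale1r.
by rewrite exprSr -mulmxE mulmxA IHN -scalemxAl vB scalerA exprSr.
Qed.

Section AbsolutelyIndecomposable.
Variables (L : finFieldType) (Q : quiver).
Implicit Types d e : vertex Q -> nat.

Definition nilpotent_family (K : fieldType) d (f : forall i, 'M[K]_(d i)) :=
  exists N, forall i, f i ^+ N = 0.

Lemma nilpotent_not_unit d (X : rep L d) (f : forall i, 'M[L]_(d i)) : indecomposable X ->
  nilpotent_family f -> ~ forall i, f i \in unitmx.
Proof.
move=> [[i di] _] [N fN] uf; case: di; apply: (@unitmx0_dim L).
by rewrite -(fN i) unitmx_exp.
Qed.

(* Over a finite field this is equivalent to absolute indecomposability, and it
   does not mention any algebraic closure. *)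
Definition split_local d (X : rep L d) := indecomposable X /\
  forall f, hom X X f -> exists l : L, nilpotent_family (fun i => f i - l%:M).

Variables (K : countClosedFieldType) (psi : {rmorphism L -> K}).
Local Notation phi := (frob psi).
Hypothesis phi_periodic : forall x, exists2 m, (0 < m)%N & iter m phi x = x.

(** Take an eigenvalue lam of f at a nonzero vertex. By Fitting, f - lam is nilpotent; applying
    Frobenius, so is f - phi(lam) at that vertex, and the eigenvector forces phi(lam) = lam, that
    is, lam in L. *)
Lemma split_local_of_base_change d (X : rep L d) :
  indecomposable (base_change psi X) -> split_local X.
Proof.
move=> indXK; split=> [|f hf]; first exact: indecomposable_base_change indXK.
have [[i0 di0] _] := indXK.
pose A i := map_mx psi (f i).
have /closed_rootP[lam] : size (char_poly (A i0)) != 1.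
  by rewrite size_char_poly eqSS; apply/eqP.
rewrite -eigenvalue_root_char => /eigenvalueP[v vA v0].
have vB l : v *m (A i0 - l%:M) = (lam - l) *: v.
  by rewrite mulmxBr vA mul_mx_scalar scalerBl.
have hB l : hom (base_change psi X) (base_change psi X) (fun i => A i - l%:M).
  apply: hom_sub; first exact: hom_base_change.
  by move=> h; rewrite mul_scalar_mx mul_mx_scalar.
case: (fitting indXK (hB lam)) => [u|[N nilB]].
  by move: v0; rewrite -(mulmxK (u i0) v) vB subrr scale0r mul0mx eqxx.
have Elam : phi lam = lam.
  have : (A i0 - (phi lam)%:M) ^+ N = 0.
    have -> : A i0 - (phi lam)%:M = map_mx phi (A i0 - lam%:M).
      rewrite map_mxB map_scalar_mx; congr (_ - _); apply/matrixP => i j.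
      by rewrite !mxE; apply/esym/frob_psi.
    by rewrite map_mx_exp nilB map_mx0.
  move/(congr1 (mulmx v)); rewrite mulmx0 (mulmx_exp_eigen _ (vB _)).
  move/eqP; rewrite scaler_eq0 (negPf v0) orbF expf_eq0 subr_eq0.
  by case/andP=> _ /eqP.
have [l El] := frob_fixed Elam; exists l, N => i.
apply: (@map_mx_inj _ _ psi); rewrite map_mx0 -map_mx_exp map_mxB map_scalar_mx -El.
exact: nilB.
Qed.

(** An idempotent over K is a combination of endomorphisms over L, each a scalar plus a nilpotent.
    The nilpotent ones form a nil algebra by locality, so e - lam is nilpotent over K; e is then
    nilpotent or invertible, hence 0 or 1. *)
Lemma base_change_of_split_local d (X : rep L d) :
  split_local X -> indecomposable (base_change psi X).
Proof.
case=> indX splX; apply: indec_of_idempotent indX.1 _ => e he ee.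
have [J [c [g [hg Ee]]]] := hom_span phi_periodic he.
pose l j := projT1 (cid (splX _ (hg j))).
pose lam := \sum_j c j * psi (l j).
pose nu j i := g j i - (l j)%:M.
have hnu j : hom X X (nu j).
  by apply: hom_sub => // h; rewrite mul_scalar_mx mul_mx_scalar.
have nil_nu j : nilpotent_family (nu j) by rewrite /nu /l; case: cid.
have nil_e i : exists N, (e i - lam%:M) ^+ N = 0.
  pose P A := exists f, [/\ hom X X f, nilpotent_family f & A = f i].
  have nilP f : hom X X f -> ~ (forall i, f i \in unitmx) -> P (f i).
    by move=> hf nu_f; exists f; case: (fitting indX hf).
  have [|A B|a A|A B|A|j|N EN] := @nil_algebra_base_change _ _ P _ _ _ _ _ K psi J c (nu^~ i).
  - by exists (fun=> 0); split=> // [h|]; [rewrite mulmx0 mul0mx | exists 1%N => k; rewrite expr1].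
  - move=> [f [hf nf ->]] [f' [hf' nf' ->]]; apply: nilP (hom_add hf hf') _ => u.
    case: (local_add indX hf hf' u); first exact: (nilpotent_not_unit indX nf).
    exact: (nilpotent_not_unit indX nf').
  - move=> [f [hf nf ->]]; apply: nilP (hom_scale a hf) _ => u.
    apply: (nilpotent_not_unit indX nf) => k; have := u k.
    by rewrite -mul_scalar_mx unitmx_mul => /andP[].
  - move=> [f [hf nf ->]] [f' [hf' nf' ->]]; apply: nilP (hom_comp hf' hf) _ => u.
    apply: (nilpotent_not_unit indX nf) => k; have := u k.
    by rewrite unitmx_mul => /andP[].
  - by move=> [f [_ [N fN] ->]]; exists N.
  - by exists (nu j).
  exists N; rewrite -EN; congr (_ ^+ N); rewrite Ee /lam.
  rewrite raddf_sum -sumrB; apply: eq_bigr => j _.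
  by rewrite /nu map_mxB map_scalar_mx scalerBr scale_scalar_mx.
have [lam0|lam0] := eqVneq lam 0; [left | right] => i; have [N EN] := nil_e i.
  move: EN; rewrite lam0 raddf0 subr0 => EN.
  have : e i *m e i ^+ N = e i.
    elim: N {EN} => [|N IHN]; first by rewrite expr0 -idmxE mulmx1.
    by rewrite exprS -mulmxE mulmxA ee.
  by rewrite EN mulmx0.
have ue : e i \in unitmx.
  have /unitmx_sub_nilpotent : ((- lam^-1) *: (e i - lam%:M)) ^+ N = 0.
    by rewrite expmxZ EN scaler0.
  rewrite scaleNr opprK scalerBr scale_scalar_mx mulVf // addrC subrK.
  by rewrite unitmxZ // unitfE invr_eq0.
by rewrite -[LHS](mulKmx ue) ee mulVmx.
Qed.

End AbsolutelyIndecomposable.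

(** Frobenius preserves the finite root set of a polynomial over L vanishing at x; being injective,
    it brings x back to itself. *)
Lemma integral_frob_periodic (L : finFieldType) (K : countClosedFieldType)
    (psi : {rmorphism L -> K}) : integralRange psi ->
  forall x, exists2 m, (0 < m)%N & iter m (frob psi) x = x.
Proof.
move=> intK x; have [p mp px] := intK x.
have [r Er] := closed_field_poly_normal (map_poly psi p).
have orbit_root j : iter j (frob psi) x \in r.
  rewrite -root_prod_XsubC; have := monic_map psi mp => /monicP mp1.
  move: Er; rewrite mp1 scale1r => <-.
  elim: j => //= j; rewrite !rootE => /eqP IHj; apply/eqP.
  have Ep : map_poly (frob psi) (map_poly psi p) = map_poly psi p.
    by apply/polyP => i; rewrite !coef_map; apply: frob_psi.
  by rewrite -Ep horner_map IHj rmorph0.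
apply: contrapT => per.
have frob_inj : injective (frob psi) by apply: fmorph_inj.
have orbit_inj : injective (fun j => iter j (frob psi) x).
  suff H j k : (j <= k)%N -> iter j (frob psi) x = iter k (frob psi) x -> j = k.
    move=> j k E; have [/H|/ltnW/H] := leqP j k; first exact.
    by move/(_ (esym E)).
  move=> jk E; apply/eqP; rewrite eqn_leq jk /= leqNgt; apply/negP => ltjk.
  apply: per; exists (k - j)%N; first by rewrite subn_gt0.
  have : iter j (frob psi) (iter (k - j) (frob psi) x) = iter j (frob psi) x.
    by rewrite -iterD subnKC.
  by elim: j {jk E ltjk} (iter _ _ x) => //= j IHj y /frob_inj/IHj.
have := @uniq_leq_size _ (mkseq (fun j => iter j (frob psi) x) (size r).+1) r.
rewrite size_mkseq ltnn => H.
suff : false by []. apply: H; first by rewrite mkseq_uniq.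
by move=> _ /mapP[j _ ->].
Qed.

(** * Counting invariant multisets *)

Section Vectors.
Local Open Scope nat_scope.
Variable I : finType.
Local Notation vec := {ffun I -> nat}.
Implicit Types u v a b : vec.

Definition wt v := \sum_i v i.
Definition vle u v := [forall i, u i <= v i].
Definition vadd u v : vec := [ffun i => u i + v i].
Definition vsub u v : vec := [ffun i => u i - v i].
Definition vscale n v : vec := [ffun i => n * v i].
Definition vzero : vec := [ffun=> 0].
(** A finite range containing all vectors of weight at most N, over which the sums over N^I are
    taken. *)
Definition box N : seq vec :=
  [seq [ffun i => val (f i)] | f : {ffun I -> 'I_N.+1}].

Lemma vleP u v : reflect (forall i, u i <= v i) (vle u v).
Proof. exact: forallP. Qed.

Lemma mem_box N v : (v \in box N) = [forall i, v i <= N].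
Proof.
apply/mapP/forallP => [[f _ ->] i|vN].
  by rewrite ffunE -ltnS ltn_ord.
exists [ffun i => inord (v i)]; first by rewrite mem_enum.
by apply/ffunP => i; rewrite !ffunE /= inordK // ltnS.
Qed.

Lemma box_uniq N : uniq (box N).
Proof.
rewrite map_inj_uniq ?enum_uniq // => f g /ffunP E; apply/ffunP => i.
by apply: val_inj; have := E i; rewrite !ffunE.
Qed.

Lemma leq_wt v i : v i <= wt v.
Proof. by rewrite /wt (bigD1 i) //= leq_addr. Qed.

Lemma mem_box_wt N v : wt v <= N -> v \in box N.
Proof. by move=> vN; rewrite mem_box; apply/forallP => i; apply: leq_trans vN; apply: leq_wt. Qed.

Lemma wt_eq0 v : (wt v == 0) = (v == vzero).
Proof.
rewrite /wt sum_nat_eq0; apply/forallP/eqP => [H|-> i]; last by rewrite ffunE.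
by apply/ffunP => i; rewrite ffunE; apply/eqP/(implyP (H i)).
Qed.

Lemma wt_add u v : wt (vadd u v) = wt u + wt v.
Proof. by rewrite /wt -big_split; apply: eq_bigr => i _; rewrite ffunE. Qed.

Lemma wt_scale n v : wt (vscale n v) = n * wt v.
Proof. by rewrite /wt big_distrr; apply: eq_bigr => i _; rewrite ffunE. Qed.

Lemma vsubK u v : vle u v -> vadd u (vsub v u) = v.
Proof. by move/vleP=> uv; apply/ffunP => i; rewrite !ffunE subnKC. Qed.

Lemma wt_sub u v : vle u v -> wt v = wt u + wt (vsub v u).
Proof. by move=> uv; rewrite -wt_add vsubK. Qed.

Lemma vle_wt u v : vle u v -> wt u <= wt v.
Proof. by move/wt_sub->; apply: leq_addr. Qed.

Lemma vle_vsub u v a :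
  vle v a && vle u (vsub a v) = vle (vadd u v) a.
Proof.
apply/andP/vleP => [[/vleP va /vleP ua] i|uva].
  by rewrite ffunE addnC -leq_subRL //; have := ua i; rewrite ffunE.
have va : vle v a by apply/vleP => i; apply: leq_trans (uva i); rewrite ffunE leq_addl.
split=> //; apply/vleP => i; rewrite ffunE leq_subRL ?(vleP _ _ va) // addnC.
by have := uva i; rewrite ffunE.
Qed.

Lemma vsubA u v a : vsub (vsub a v) u = vsub a (vadd u v).
Proof. by apply/ffunP => i; rewrite !ffunE addnC subnDA. Qed.

Lemma vaddC u v : vadd u v = vadd v u.
Proof. by apply/ffunP => i; rewrite !ffunE addnC. Qed.

Lemma vscaleDl m n v : vscale (m + n) v = vadd (vscale m v) (vscale n v).
Proof. by apply/ffunP => i; rewrite !ffunE mulnDl. Qed.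

Lemma vle_box N u v : vle u v -> v \in box N -> u \in box N.
Proof.
by move=> /vleP uv; rewrite !mem_box => /forallP vN; apply/forallP => i; apply: leq_trans (vN i).
Qed.

Lemma big_box_pred1 (R : Type) (idx : R) (op : Monoid.com_law idx) N (P : pred vec) v F :
  v \in box N -> P v -> \big[op/idx]_(u <- box N | P u && (u == v)) F u = F v.
Proof.
move=> vN Pv; rewrite (eq_bigl (pred1 v)) => [|u /=].
  by rewrite -big_filter filter_pred1_uniq ?box_uniq // big_seq1.
by case: eqP => [->|]; rewrite ?andbF ?andbT.
Qed.

End Vectors.

(** * Cycles of a periodic permutation *)

Section Period.
Local Open Scope nat_scope.
Variables (T : choiceType) (sig : T -> T).
Hypothesis sig_per : forall t, exists2 m, 0 < m & iter m sig t = t.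
Local Open Scope mset_scope.
Implicit Types A : {mset T}.

Lemma per_inj : injective sig.
Proof.
move=> x y E; have [m m0 mx] := sig_per x; have [n n0 ny] := sig_per y.
have itm k z l : iter l sig z = z -> iter (k * l) sig z = z.
  by move=> lz; elim: k => // k IHk; rewrite mulSn iterD IHk.
rewrite -(itm n _ _ mx) -(itm m _ _ ny) mulnC.
by case: m m0 {mx} => // m _; case: n n0 {ny} => // n _; rewrite mulSn addSn !iterSr E.
Qed.

Lemma iter_per_inj k : injective (iter k sig).
Proof. by elim: k => // k IHk x y /= /per_inj/IHk. Qed.

Definition invariant_mset A := forall t, A (sig t) = A t.

Lemma invariant_iter A k t : invariant_mset A -> A (iter k sig t) = A t.
Proof. by move=> iA; elim: k => //= k <-; rewrite iA. Qed.

Definition cycle_mset n y : {mset T} := seq_mset (traject sig y n).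

Lemma cycle_mset_invariant n y : iter n sig y = y -> invariant_mset (cycle_mset n y).
Proof.
move=> ny t; rewrite !mset_seqE.
have -> : count_mem t (traject sig y n) = count_mem (sig t) (traject sig (sig y) n).
  have -> : traject sig (sig y) n = map sig (traject sig y n).
    by elim: n y {ny} => //= n IHn y; rewrite IHn.
  rewrite count_map; apply: eq_count => x /=.
  by rewrite (inj_eq per_inj).
case: n ny => // n ny; rewrite [in RHS]trajectSr /= -iterSr ny -cats1 count_cat /= addn0.
by rewrite addnC.
Qed.

(* If y has period r, then n must be a multiple k * r, and the cycle of length
   k * r is k times the orbit of y; it is contained in A exactly when k <= A y. *)
Lemma orbit_count_cycles A y N : invariant_mset A -> (forall n, iter n sig y = y ->
   cycle_mset n y `<=` A -> n <= N) ->
  count (fun n => (iter n.+1 sig y == y) && (cycle_mset n.+1 y `<=` A)) (iota 0 N) = A y.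
Proof.
move=> iA leN.
have exr : exists r, (0 < r) && (iter r sig y == y).
  by have [r r0 ry] := sig_per y; exists r; rewrite r0 ry eqxx.
case: (ex_minnP exr) => r /andP[r0 /eqP ry] minr.
have iterMr k : iter (k * r) sig y = y.
  by elim: k => // k IHk; rewrite mulSn iterD IHk.
have perP n : (iter n sig y == y) = (r %| n).
  apply/eqP/idP => [ny|/dvdnP[k ->]//].
  apply: contraT => rn; have := minr (n %% r).
  rewrite [r <= _]leqNgt ltn_pmod // lt0n rn => /implyP; rewrite implybF.
  by move: ny; rewrite {1}(divn_eq n r) addnC iterD iterMr => ->; rewrite eqxx.
have trajE k t : count_mem t (traject sig y (k * r)) = k * count_mem t (traject sig y r).
  by elim: k => // k IHk; rewrite mulSn trajectD count_cat ry IHk mulSn.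
have uniq_traj : uniq (traject sig y r).
  have it_lt i j : i <= j < r -> iter i sig y = iter j sig y -> i = j.
    case/andP=> ij jr E; apply/eqP; rewrite eqn_leq ij leqNgt; apply/negP => ltij.
    have /minr : (0 < j - i) && (iter (j - i) sig y == y).
      rewrite subn_gt0 ltij /=; apply/eqP/(@iter_per_inj i).
      by rewrite -iterD subnKC.
    by rewrite leqNgt (leq_ltn_trans (leq_subr _ _) jr).
  apply/(uniqP y) => i j; rewrite !inE size_traject => ir jr.
  rewrite !nth_traject // => E; have [ij|/ltnW ij] := leqP i j.
    by apply: it_lt; rewrite ?ij.
  by apply/esym/it_lt; rewrite ?ij.
have cycP k : (cycle_mset (k * r) y `<=` A) = (k <= A y).
  apply/msubsetP/idP => [/(_ y)|kA t]; rewrite mset_seqE trajE count_uniq_mem //.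
    by case: r r0 {ry minr iterMr perP trajE uniq_traj} => // r _; rewrite mem_head muln1.
  have [/trajectP[j _ ->]|] := boolP (t \in _); last by rewrite muln0.
  by rewrite muln1 invariant_iter.
(* Index n stands for length n + 1. The admissible lengths are the multiples (k + 1) r with k < A y,
   whence the bijection k |-> (k + 1) r - 1. *)
rewrite -size_filter -[RHS](size_iota 0) -[RHS](size_map (fun k => (k.+1 * r).-1)).
apply/perm_size/uniq_perm; first by rewrite filter_uniq ?iota_uniq.
  rewrite map_inj_uniq ?iota_uniq // => j k E.
  have : j.+1 * r = k.+1 * r by rewrite -[LHS]prednK ?muln_gt0 // E prednK ?muln_gt0.
  by move/eqP; rewrite eqn_pmul2r // => /eqP[].
move=> n; rewrite mem_filter mem_iota add0n leq0n; cbv beta; rewrite perP andTb.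
apply/andP/mapP => [[/andP[/dvdnP[k Ek] nA] nN]|[k + ->]].
  case: k Ek => // k Ek; exists k; last by rewrite -Ek.
  by rewrite mem_iota /= add0n -cycP -Ek.
rewrite mem_iota /= add0n => kA; rewrite prednK ?muln_gt0 // dvdn_mull // cycP kA; split=> //.
by apply: leN; rewrite ?cycP.
Qed.

End Period.

(** * The weighted double count *)

Section Recursion.
Local Open Scope nat_scope.
Variables (T : choiceType) (sig : T -> T).
Hypothesis sig_per : forall t, exists2 m, 0 < m & iter m sig t = t.
Variables (I : finType) (w : T -> {ffun I -> nat}) (V : pred {ffun I -> nat}).
Hypothesis w_sig : forall t, w (sig t) = w t.
Hypothesis w_gt0 : forall t, 0 < wt (w t).
Local Open Scope mset_scope.
Implicit Types (A B : {mset T}) (a b : {ffun I -> nat}).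

Lemma big_msetD A B (F : T -> nat) :
  \sum_(t <- A `+` B) F t = \sum_(t <- A) F t + \sum_(t <- B) F t.
Proof.
rewrite -big_cat; apply: perm_big; apply/allP => t _ /=.
by rewrite count_cat !count_mem_mset msetE2.
Qed.

Lemma iter_w k t : w (iter k sig t) = w t.
Proof. by elim: k => //= k <-. Qed.

Lemma sum_cycle_mset n y i :
  \sum_(t <- cycle_mset sig n y) w t i = n * w y i.
Proof.
rewrite (perm_big _ (perm_eq_seq_mset _)) /=.
by elim: n y => [|n IHn] y; rewrite ?big_nil //= big_cons IHn w_sig mulSn.
Qed.

Definition mset_dim a A := forall i, a i = \sum_(t <- A) w t i.

Lemma wt_mset_dim a A : mset_dim a A -> wt a = \sum_(t <- A) wt (w t).
Proof.
by move=> E; rewrite exchange_big; apply: eq_bigr => i _; rewrite E.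
Qed.

Lemma msubset_dim A B a b : A `<=` B -> mset_dim a A -> mset_dim b B -> vle a b.
Proof.
move=> /msubsetP AB dA dB; apply/vleP => i; rewrite dA dB.
have -> : B = (B `\` A) `+` A by apply/msetP => t; rewrite !msetE2 subnK.
by rewrite big_msetD leq_addl.
Qed.

Variables (Ms : {ffun I -> nat} -> seq {mset T}).
Hypothesis Ms_uniq : forall a, uniq (Ms a).
Hypothesis Ms_mem : forall a A, reflect
  [/\ invariant_mset sig A, forall t, t \in A -> V (w t) & mset_dim a A] (A \in Ms a).

Variables (As : nat -> {ffun I -> nat} -> seq T).
Hypothesis As_uniq : forall n b, uniq (As n b).
Hypothesis As_mem : forall n b y,
  (y \in As n b) = (w y == b) && (iter n.+1 sig y == y).

(** The cycle is itself invariant of dimension (n + 1) b, so removing it and adding it back are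
    inverse bijections. *)
Lemma count_containing_cycle n b a y : V b -> y \in As n b ->
  vle (vscale n.+1 b) a ->
  count (fun A => cycle_mset sig n.+1 y `<=` A) (Ms a) =
  size (Ms (vsub a (vscale n.+1 b))).
Proof.
move=> Vb; rewrite As_mem => /andP[/eqP wy /eqP ny] le_ba.
set C := cycle_mset _ _ _.
have invC : invariant_mset sig C by apply: cycle_mset_invariant.
have dimC : mset_dim (vscale n.+1 b) C by move=> i; rewrite sum_cycle_mset wy ffunE.
rewrite -size_filter -[RHS](size_map (fun A => A `+` C)).
apply/perm_size/uniq_perm; first by rewrite filter_uniq.
  rewrite map_inj_uniq // => A B /msetP E; apply/msetP => t.
  by have := E t; rewrite !msetE2 => /addIn.
move=> A; rewrite mem_filter; apply/andP/mapP => [[/msubsetP CA /Ms_mem[iA VA dA]]|].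
  have EA : A = (A `\` C) `+` C by apply/msetP => t; rewrite !msetE2 subnK.
  exists (A `\` C) => //; apply/Ms_mem; split.
  - by move=> t; rewrite !msetE2 iA invC.
  - by move=> t; rewrite in_msetB => tA; apply: VA; rewrite in_mset; apply: leq_ltn_trans tA.
  - by move=> i; rewrite ffunE dA dimC {1}EA big_msetD addnK.
move=> [B /Ms_mem[iB VB dB] ->]; split.
  by apply/msubsetP => t; rewrite msetE2 leq_addl.
apply/Ms_mem; split.
- by move=> t; rewrite !msetE2 iB invC.
- move=> t; rewrite in_msetD => /orP[/VB //|].
  rewrite (perm_mem (perm_eq_seq_mset _)) => /trajectP[j _ ->].
  by rewrite iter_w wy.
- by move=> i; rewrite big_msetD -dB -dimC -[in LHS](vsubK le_ba) ffunE addnC.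
Qed.

(** In the weight of A, written as a sum over its points, the multiplicity A y is replaced by the
    number of cycles from y contained in A, by [orbit_count_cycles]; the points are then sorted by
    dimension b. *)
Lemma wt_as_cycle_count a A N : A \in Ms a -> wt a <= N ->
  wt a = \sum_(n <- iota 0 N) \sum_(b <- box I N | V b && vle (vscale n.+1 b) a)
    wt b * count (fun y => cycle_mset sig n.+1 y `<=` A) (As n b).
Proof.
move=> /Ms_mem[iA VA dA] aN.
have cyc_dim n y : cycle_mset sig n y `<=` A -> vle (vscale n (w y)) a.
  move=> CA; apply: msubset_dim CA _ dA => i.
  by rewrite sum_cycle_mset ffunE.
pose c n y := (iter n.+1 sig y == y) && (cycle_mset sig n.+1 y `<=` A).
transitivity (\sum_(n <- iota 0 N) \sum_(y <- finsupp A | c n y) wt (w y)).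
  rewrite (wt_mset_dim dA) sum_mset.
  under [RHS]eq_bigr => n _ do rewrite big_mkcond.
  rewrite exchange_big /=; apply: eq_bigr => y _.
  rewrite -big_mkcond /= big_const_seq iter_addn_0 mulnC.
  (* Lengths up to N suffice: a cycle of length n inside A has weight at least n, since each point
     has positive weight. *)
  congr (_ * _); apply/esym/(orbit_count_cycles sig_per iA) => n _ /cyc_dim/vle_wt.
  rewrite wt_scale => le_n; apply: leq_trans aN; apply: leq_trans le_n.
  by rewrite leq_pmulr.
apply: eq_bigr => n _.
transitivity (\sum_(b <- box I N | V b && vle (vscale n.+1 b) a)
  \sum_(y <- finsupp A | c n y && (w y == b)) wt b); last first.
  apply: eq_bigr => b _; rewrite big_const_seq iter_addn_0; congr (_ * _).
  rewrite -!size_filter; apply/perm_size/uniq_perm; rewrite ?filter_uniq // => y.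
  rewrite !mem_filter As_mem msuppE /c; cbv beta.
  apply/andP/and3P => [[/andP[/andP[ny CA] wy] _]//|[CA wy ny]].
  rewrite CA wy ny; split=> //; rewrite in_mset; have /msubsetP/(_ y) := CA.
  by apply: leq_trans; rewrite -in_mset (perm_mem (perm_eq_seq_mset _)) mem_head.
rewrite (exchange_big_dep (fun y => c n y)) /= => [|b y _ /andP[] //].
rewrite big_seq_cond [RHS]big_seq_cond; apply: eq_bigr => y /andP[yA cy].
rewrite (eq_bigl (fun b => (V b && vle (vscale n.+1 b) a) && (b == w y))) => [|b].
  have [_ CA] := andP cy; rewrite big_box_pred1 //.
    apply: vle_box (mem_box_wt aN); apply/vleP => i.
    have /vleP/(_ i) := cyc_dim _ _ CA; rewrite ffunE; apply: leq_trans.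
    by rewrite mulSn leq_addr.
  by rewrite VA ?cyc_dim // -msuppE.
by rewrite cy /= eq_sym.
Qed.

Theorem cycle_recursion a N : wt a <= N -> wt a * size (Ms a) =
  \sum_(n <- iota 0 N) \sum_(b <- box I N | V b && vle (vscale n.+1 b) a)
    wt b * (size (As n b) * size (Ms (vsub a (vscale n.+1 b)))).
Proof.
move=> aN.
transitivity (\sum_(A <- Ms a) \sum_(n <- iota 0 N)
  \sum_(b <- box I N | V b && vle (vscale n.+1 b) a)
    wt b * count (fun y => cycle_mset sig n.+1 y `<=` A) (As n b)).
  rewrite mulnC -sum1_size big_distrl /= big_seq [RHS]big_seq.
  by apply: eq_bigr => A AM; rewrite mul1n (wt_as_cycle_count AM aN).
rewrite exchange_big; apply: eq_bigr => n _ /=.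
rewrite exchange_big; apply: eq_bigr => b /andP[Vb le_ba] /=.
rewrite -big_distrr /=; congr (_ * _).
under eq_bigr => A _ do rewrite -sum1_count big_mkcond.
rewrite exchange_big /= big_seq.
under eq_bigr => y yA do rewrite -big_mkcond sum1_count (count_containing_cycle Vb yA le_ba).
by rewrite -big_seq big_const_seq count_predT iter_addn_0 mulnC.
Qed.

End Recursion.

(** * Representations over finite fields as invariant multisets *)

Lemma num_iso_classes_size (Q : quiver) (F : finFieldType) (d : vertex Q -> nat)
    (P : rep F d -> Prop) (T : eqType) (kappa : rep F d -> T) (s : seq T) :
  (forall X Y, kappa X = kappa Y <-> iso X Y) -> uniq s ->
  (forall t, t \in s <-> exists X, P X /\ kappa X = t) ->
  num_iso_classes P = size s.
Proof.
move=> kappaP us mem_s; rewrite /num_iso_classes /equivalence_partition.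
set D := finset _; pose h t := [set Y in D | kappa Y == t]%SET.
have inD X : (X \in D) = `[< P X >] by rewrite inE.
have gE X : [set Y in D | `[< iso X Y >]]%SET = h (kappa X).
  apply/setP => Y; rewrite !inE; congr (_ && _).
  by apply/asboolP/eqP => [/iso_sym/kappaP|/esym/kappaP].
have -> : [set [set Y in D | `[< iso X Y >]]%SET | X in D]%SET = [set:: map h s]%SET.
  apply/setP => B; rewrite inE; apply/imsetP/mapP => [[X XD ->]|[t ts ->]].
    exists (kappa X); last exact: gE.
    by apply/mem_s; exists X; split=> //; move: XD; rewrite inD => /asboolP.
  have /mem_s[X [PX <-]] := ts; exists X; last by rewrite gE.
  by rewrite inD; apply/asboolP.
rewrite cardsE; have /card_uniqP-> : uniq (map h s); last by rewrite size_map.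
rewrite map_inj_in_uniq // => t t' /mem_s[X [PX Xt]] _ /setP/(_ X).
by rewrite !inE Xt eqxx (asboolT PX) /= => /esym/eqP.
Qed.

Lemma mset1_inj (T : choiceType) : injective (fun y : T => [mset y]%mset).
Proof. by move=> y z /msetP/(_ y); rewrite !msetnE eqxx; case: eqP. Qed.

Section FrobeniusAction.
Variables (F : finFieldType) (K : countClosedFieldType) (psi : {rmorphism F -> K}).
Local Notation phi := (frob psi).
Hypothesis phi_periodic : forall x, exists2 m, (0 < m)%N & iter m phi x = x.
Variable Q : quiver.
Implicit Types d e : vertex Q -> nat.
Local Notation T := (indec_class Q K).
Local Notation twist := (@base_change Q K K phi _).

Lemma iter_twistE d (X : rep K d) j h a b :
  iter j twist X h a b = iter j phi (X h a b).
Proof. by elim: j => //= j <-; rewrite ffunE mxE. Qed.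

Lemma twist_rep_periodic d (X : rep K d) :
  exists2 m, (0 < m)%N & iter m twist X = X.
Proof.
have [m m0 Hm] := common_period phi_periodic
  (fun z : {h : arrow Q & ('I_(d (tgt h)) * 'I_(d (src h)))%type} =>
     X (tag z) (tagged z).1 (tagged z).2).
exists m => //; apply/ffunP => h; apply/matrixP => a b; rewrite iter_twistE.
exact: (Hm (@Tagged _ h (fun h => ('I_(d (tgt h)) * 'I_(d (src h)))%type) (a, b))).
Qed.

(** Twisting further brings [twist X] back to X by periodicity, and indecomposability after base
    change implies it before. *)
Lemma indecomposable_twist d (X : rep K d) :
  indecomposable X -> indecomposable (twist X).
Proof.
have [[|m] // _ Hm] := twist_rep_periodic X => indX.
have : indecomposable (iter m twist (twist X)) by rewrite -iterSr Hm.
elim: m (twist X) {Hm} => //= m IHm Y /indecomposable_base_change.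
exact: IHm.
Qed.

Definition indec_twist (t : T) : T :=
  projT1 (cid (indec_class_surj (indecomposable_twist (indec_classP t)))).
Local Notation sig := indec_twist.

Lemma indec_twistP t : iso (twist (indec_rep t)) (indec_rep (sig t)).
Proof. by rewrite /indec_twist; case: cid. Qed.

Lemma iter_indec_twistP j t :
  iso (iter j twist (indec_rep t)) (indec_rep (iter j sig t)).
Proof.
elim: j => [|j IHj] /=; first exact: iso_refl.
exact: iso_trans (iso_base_change phi IHj) (indec_twistP _).
Qed.

Lemma indec_twist_periodic t : exists2 m, (0 < m)%N & iter m sig t = t.
Proof.
have [m m0 Hm] := twist_rep_periodic (indec_rep t); exists m => //.
apply: indec_class_inj; apply: iso_trans (iso_sym (iter_indec_twistP m t)) _.
by rewrite Hm; apply: iso_refl.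
Qed.

Definition indec_dim (t : T) : dimvec Q := tag (val t).

Lemma indec_dim_twist t : indec_dim (sig t) = indec_dim t.
Proof.
by apply/ffunP => i; rewrite /indec_dim -(congr1 (@^~ i) (iso_dim (indec_twistP t))).
Qed.

Lemma wt_indec_dim_gt0 t : (0 < wt (indec_dim t))%N.
Proof.
case: (indec_classP t) => -[i ti] _; rewrite lt0n; apply/negP => /eqP w0.
by case: ti; apply/eqP; rewrite -leqn0 -w0 leq_wt.
Qed.

Lemma twist_csum s : iso (twist (csum s)) (csum (map sig s)).
Proof.
elim: s => [|t s IHs]; first by apply: iso_zero.
have -> : twist (csum (t :: s)) = dsum (twist (indec_rep t)) (twist (csum s)).
  exact: base_change_dsum.
exact: iso_dsum (indec_twistP t) IHs.
Qed.

Lemma classes_twist d (X : rep K d) t : classes (twist X) (sig t) = classes X t.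
Proof.
have /eq_classes-> : iso (twist X) (csum (map sig (classes X))).
  apply: iso_trans (twist_csum _); apply: iso_base_change.
  exact: iso_csum_classes.
rewrite classes_csum mset_seqE count_map -[RHS]count_mem_mset.
apply: eq_count => u /=; rewrite (inj_eq (per_inj indec_twist_periodic)).
by [].
Qed.

Lemma classes_rational_invariant d (X : rep F d) :
  invariant_mset sig (classes (base_change psi X)).
Proof. by move=> t; rewrite -{1}(base_change_frob psi X) classes_twist. Qed.

Lemma rational_of_invariant (a : dimvec Q) A : invariant_mset sig A ->
  mset_dim indec_dim a A -> exists X : rep F a, classes (base_change psi X) = A.
Proof.
move=> iA dA.
have [X XA] : exists X : rep K a, iso X (csum A).
  have <- : bdim (map val A) = a by apply/funext => i; rewrite dim_csum dA.
  by exists (csum A); apply: iso_refl.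
have cX : classes X = A by rewrite -[RHS]seq_mset_id; apply/iso_classes.
have [|X0 isoX0] := @rep_descent _ _ psi phi_periodic _ _ X.
  apply/eq_classes/msetP => t.
  (* Periodicity writes t as [sig] of another class, which is what [classes_twist] needs. *)
  have [[|m] m_gt0 mt] := indec_twist_periodic t; first by rewrite ltnn in m_gt0.
  by rewrite -mt iterS classes_twist cX iA.
by exists X0; rewrite -cX; apply/esym/eq_classes.
Qed.

(** Base change to K followed by [classes] separates isomorphism classes by [iso_descent] and
    reaches every invariant multiset by [rational_of_invariant]. The list is finite because there
    are finitely many matrices over F. *)
Lemma level_classes (V : set (dimvec Q)) (a : dimvec Q) : exists s : seq {mset T}%mset,
  [/\ uniq s,
      size s = num_iso_classes (fun X : rep F a =>
        (indec_summand_dims (base_change psi X) `<=` V)%classic) &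
      forall A : {mset T}%mset, A \in s <-> [/\ invariant_mset sig A,
         forall t, t \in A -> `[< V (indec_dim t) >] & mset_dim indec_dim a A]].
Proof.
set P := fun X : rep F a => _.
pose kappa (X : rep F a) := classes (base_change psi X).
pose s := undup (map kappa (enum (finset (fun X => `[< P X >])))).
have mem_s (A : {mset T}%mset) : A \in s <-> exists X, P X /\ kappa X = A.
  rewrite mem_undup; split=> [/mapP[X XP ->]|[X [PX <-]]].
    by exists X; split=> //; move: XP; rewrite mem_enum inE => /asboolP.
  by apply: map_f; rewrite mem_enum inE; apply/asboolP.
exists s; split=> [||A]; first exact: undup_uniq.
  apply/esym/(num_iso_classes_size (kappa := kappa)) => // [X Y|].
    split=> [/eq_classes/(iso_descent phi_periodic) //|XY].
    exact/eq_classes/iso_base_change.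
  exact: undup_uniq.
split=> [/mem_s[X [PX <-]]|[iA VA /(rational_of_invariant iA)[X XA]]].
  split=> [|t tX|i]; first exact: classes_rational_invariant.
    by apply/asboolP/PX/indec_summand_dimsP; exists t.
  exact: dim_classes.
apply/mem_s; exists X; split=> // b /indec_summand_dimsP[t].
by rewrite XA => /VA/asboolP Vt <-.
Qed.

Section Subfield.
Variable n : nat.
Local Notation E := (subfield psi n : finFieldType).
Local Notation psi_n := (subfield_incl psi n).

Lemma frob_subfield x : frob psi_n x = iter n.+1 phi x.
Proof. by rewrite iter_frob /frob card_subfield. Qed.

Lemma frob_subfield_periodic x :
  exists2 m, (0 < m)%N & iter m (frob psi_n) x = x.
Proof.
have [m m0 Hm] := phi_periodic x; exists m => //.
have -> : iter m (frob psi_n) x = iter (m * n.+1) phi x.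
  by elim: m {m0 Hm} => // m IHm; rewrite iterS IHm frob_subfield -iterD -mulSn.
by rewrite mulnC iter_mul.
Qed.

Lemma base_change_frob_subfield d (X : rep K d) :
  base_change (frob psi_n) X = iter n.+1 twist X.
Proof.
apply/ffunP => h; apply/matrixP => i j; rewrite iter_twistE ffunE mxE.
exact: frob_subfield.
Qed.

(** The left side refers to the closure chosen for E, the right side to K; each is equivalent to
    [split_local] over E. *)
Lemma abs_indecomposable_subfield d (X : rep E d) :
  abs_indecomposable X <-> indecomposable (base_change psi_n X).
Proof.
have perE := integral_frob_periodic (svalP (projT2 (countable_algebraic_closure E))).
split=> [/split_local_of_base_change|/split_local_of_base_change].
  exact: base_change_of_split_local frob_subfield_periodic _ _.
exact: base_change_of_split_local perE _ _.
Qed.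

(** Frobenius over E is the (n + 1)-st power of [phi], so a class fixed by sig^(n + 1) descends to
    E, and the multiset of an absolutely indecomposable representation is a single such class. *)
Lemma abs_indecomposable_classes (b : dimvec Q) : exists s : seq T,
  [/\ uniq s,
      size s = num_iso_classes (fun X : rep E b => abs_indecomposable X) &
      forall y, (y \in s) = (indec_dim y == b) && (iter n.+1 sig y == y)].
Proof.
set P := fun X : rep E b => _.
pose kappa (X : rep E b) := classes (base_change psi_n X).
pose ms := map kappa (enum (finset (fun X => `[< P X >]))).
pose s : seq T := undup (flatten (map (fun A : {mset T}%mset => A : seq T) ms)).
have mem_s y : reflect (exists X, P X /\ kappa X = [mset y]%mset) (y \in s).
  rewrite mem_undup; apply: (iffP flattenP) => [[_ /mapP[A /mapP[X XP ->] ->]]|[X [PX EX]]].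
    move: XP; rewrite mem_enum inE => /asboolP PX.
    have /abs_indecomposable_subfield/indec_classes[t Et] := PX.
    rewrite /kappa Et => yt; exists X; split; first exact: PX.
    move: yt; rewrite -[y \in _]/(y \in [mset t]%mset) in_mset1 => /eqP->.
    exact: Et.
  exists (enum_mset (kappa X)); last by rewrite EX -[y \in _]/(y \in [mset y]%mset) in_mset1.
  apply: (map_f (fun A : {mset T}%mset => A : seq T)); apply: map_f.
  by rewrite mem_enum inE; apply/asboolP; exact: PX.
exists s; split=> [||y]; first exact: undup_uniq.
  rewrite -(size_map (fun y => [mset y]%mset)).
  apply/esym/(num_iso_classes_size (kappa := kappa)) => // [X Y||A].
  - split=> [/eq_classes/(iso_descent frob_subfield_periodic) //|XY].
    exact/eq_classes/iso_base_change.
  - rewrite map_inj_uniq; first exact: undup_uniq.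
    exact: mset1_inj.
  - split=> [/mapP[y /mem_s[X [PX EX]] ->]|[X [PX <-]]]; first by exists X.
    have /abs_indecomposable_subfield/indec_classes[t Et] := PX.
    by apply/mapP; exists t => //; apply/mem_s; exists X.
apply/mem_s/andP => [[X [PX EX]]|[/eqP dy /eqP ny]].
  have isoX : iso (base_change psi_n X) (indec_rep y).
    by apply/eq_classes; rewrite classes_indec.
  split; first by apply/eqP/ffunP => i; rewrite /indec_dim -(congr1 (@^~ i) (iso_dim isoX)).
  apply/eqP/indec_class_inj/(iso_trans (iso_sym (iter_indec_twistP n.+1 y))).
  rewrite -base_change_frob_subfield.
  apply: iso_trans (iso_base_change _ (iso_sym isoX)) _.
  by rewrite base_change_frob.
have [|X0 isoX0] := @rep_descent _ _ psi_n frob_subfield_periodic _ _ (indec_rep y).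
  rewrite base_change_frob_subfield.
  by apply: iso_trans (iter_indec_twistP n.+1 y) _; rewrite ny; apply: iso_refl.
have [X XX0] : exists X : rep E b, iso X X0.
  by rewrite -dy; exists X0; apply: iso_refl.
have kX : kappa X = [mset y]%mset.
  rewrite -classes_indec; apply/eq_classes/(iso_trans (iso_base_change _ XX0)).
  exact: iso_sym.
exists X; split=> //; apply/abs_indecomposable_subfield/indec_classes.
by exists y.
Qed.

End Subfield.

End FrobeniusAction.

Theorem num_iso_classes_recursion (Q : quiver) (F : finFieldType) (V : set (dimvec Q))
    (a : dimvec Q) N : (wt a <= N)%N ->
  let level b := num_iso_classes (fun X : rep F b => level_at_most V X) in
  (wt a * level a = \sum_(n <- iota 0 N)
    \sum_(b <- box (vertex Q) N | `[< V b >] && vle (vscale n.+1 b) a)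
      wt b * (num_iso_classes (fun X : rep (subfield (to_algclosure F) n) b =>
                abs_indecomposable X)
              * level (vsub a (vscale n.+1 b))))%N.
Proof.
move=> aN level.
have per := integral_frob_periodic (svalP (projT2 (countable_algebraic_closure F))).
pose Ms b := projT1 (cid (level_classes per V b)).
pose As n b := projT1 (cid (abs_indecomposable_classes (Q := Q) per n b)).
have MsP b : [/\ uniq (Ms b), size (Ms b) = level b &
    forall A : {mset (indec_class Q (algclosure F))}%mset, A \in Ms b <->
    [/\ invariant_mset (indec_twist per (Q := Q)) A,
      forall t, t \in A -> `[< V (indec_dim t) >] &
      mset_dim (@indec_dim _ Q) b A]].
  rewrite /Ms; case: cid => s /= [us ss mem_s].
  split; [exact: us | exact: ss | exact: mem_s].
have AsP n b : [/\ uniq (As n b), size (As n b) = num_iso_classes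
      (fun X : rep (subfield (to_algclosure F) n) b => abs_indecomposable X) &
    forall y, (y \in As n b) =
      (indec_dim y == b) && (iter n.+1 (indec_twist per (Q := Q)) y == y)].
  rewrite /As; case: cid => s /= [us ss mem_s].
  split; [exact: us | exact: ss | exact: mem_s].
have := @cycle_recursion _ _ (indec_twist_periodic per (Q := Q)) _ (@indec_dim _ Q)
  (fun b => `[< V b >]) (indec_dim_twist per (Q := Q)) (@wt_indec_dim_gt0 _ Q) Ms _ _ As _ _ a N aN.
have -> : size (Ms a) = level a by case: (MsP a).
move=> -> //; first last.
- by move=> n b; case: (AsP n b).
- by move=> n b; case: (AsP n b).
- by move=> b A; case: (MsP b) => _ _ mem_s; apply: equivP idP (mem_s A).
- by move=> b; case: (MsP b).
apply: eq_bigr => n _; apply: eq_bigr => b _; congr (_ * (_ * _))%N.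
  by case: (AsP n b).
by case: (MsP (vsub a (vscale n.+1 b))).
Qed.

(** * The plethystic exponential *)

Lemma natr_Qt_eq0 n : (n%:R == 0 :> Qt) = (n == 0%N).
Proof.
rewrite -(rmorph_nat (@tofrac {poly rat})) tofrac_eq0 -polyC_natr polyC_eq0.
exact: Num.Theory.pnatr_eq0.
Qed.

Fact Qt_of_intpoly_zmod : zmod_morphism Qt_of_intpoly.
Proof. by move=> p q; rewrite /Qt_of_intpoly !rmorphB. Qed.

Fact Qt_of_intpoly_monoid : monoid_morphism Qt_of_intpoly.
Proof. by split=> [|p q]; rewrite /Qt_of_intpoly ?rmorph1 ?rmorphM. Qed.

HB.instance Definition _ :=
  GRing.isZmodMorphism.Build {poly int} Qt Qt_of_intpoly Qt_of_intpoly_zmod.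
HB.instance Definition _ :=
  GRing.isMonoidMorphism.Build {poly int} Qt Qt_of_intpoly Qt_of_intpoly_monoid.

Lemma Qt_of_intpoly_inj : injective Qt_of_intpoly.
Proof.
move=> p q /eqP; rewrite /Qt_of_intpoly tofrac_eq => /eqP.
apply: map_inj_poly; last by rewrite rmorph0.
exact: intr_inj.
Qed.

(** Whatever representative r is chosen, its numerator is p times its denominator, and the latter
    stays nonzero after the substitution. *)
Lemma Qt_adams_tofrac n (p : {poly rat}) : (0 < n)%N ->
  Qt_adams n (tofrac p) = tofrac (p \Po 'X^n).
Proof.
move=> n0; rewrite /Qt_adams; set r := repr (tofrac p).
have E : \n_r = p * \d_r.
  have := FracField.equivf_r (Ratio p 1).
  by rewrite !numden_Ratio ?oner_eq0 // mul1r /r /tofrac -lock => ->.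
rewrite E comp_polyM rmorphM mulfK // tofrac_eq0 comp_poly_eq0 ?denom_ratioP //.
by rewrite size_polyXn ltnS.
Qed.

Lemma Qt_adams_intpoly n (p : {poly int}) : (0 < n)%N ->
  Qt_adams n (Qt_of_intpoly p) = Qt_of_intpoly (p \Po 'X^n).
Proof.
move=> n0; rewrite /Qt_of_intpoly Qt_adams_tofrac //.
by rewrite map_comp_poly map_polyXn.
Qed.

Section Series.
Variable I : finType.
Local Notation vec := {ffun I -> nat}.
Local Notation zero := (vzero I).
Implicit Types (a b u v : vec) (f g h : series I) (N n k : nat).

Lemma wt0 : wt zero = 0%N.
Proof. by apply/eqP; rewrite wt_eq0. Qed.

Lemma series_mulE N f g a : a \in box I N -> series_mul f g a =
  \sum_(b <- box I N | vle b a) f b * g (vsub a b).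
Proof.
move=> aN; rewrite /series_mul.
rewrite (fsbig_fwiden [seq (b, vsub a b) | b <- box I N & vle b a]).
- by rewrite big_map big_filter.
- move=> [u v] /= uv; apply/mapP; exists u.
    have ua : vle u a by apply/vleP => i; rewrite -uv leq_addr.
    by rewrite mem_filter ua (vle_box ua).
  by congr (_, _); apply/ffunP => i; rewrite ffunE -uv addKn.
- by rewrite map_inj_uniq ?filter_uniq ?box_uniq // => b c [].
move=> p [/mapP[b]]; rewrite mem_filter => /andP[/vleP ba _] -> /=.
by case=> i /=; rewrite ffunE subnKC.
Qed.

Lemma vsub_box N a b : a \in box I N -> vsub a b \in box I N.
Proof. by apply: vle_box; apply/vleP => i; rewrite ffunE leq_subr. Qed.

Lemma series_mulCA f g h : series_mul f (series_mul g h) = series_mul g (series_mul f h).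
Proof.
apply/funext => a; have aN := mem_box_wt (leqnn (wt a)).
have H f' g' : series_mul f' (series_mul g' h) a = \sum_(b <- box I (wt a))
    \sum_(c <- box I (wt a) | vle (vadd b c) a) f' b * g' c * h (vsub a (vadd b c)).
  rewrite (series_mulE _ _ aN) big_mkcond; apply: eq_bigr => b _.
  case: ifP => ba; last first.
    rewrite big1 // => c /vleP bca; case/negP: (negbT ba).
    by apply/vleP => i; apply: leq_trans (bca i); rewrite ffunE leq_addr.
  rewrite (series_mulE _ _ (vsub_box b aN)) mulr_sumr; apply: eq_big => [c|c _].
    by apply/vleP/vleP => bca i; have := bca i; rewrite !ffunE leq_subRL ?(vleP _ _ ba).
  by rewrite mulrA; congr (_ * h _); apply/ffunP => i; rewrite !ffunE subnDA.
rewrite !H (exchange_big_dep xpredT) //=; apply: eq_bigr => c _; apply: eq_big => [b|b _].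
  by congr (vle _ a); apply/ffunP => i; rewrite !ffunE addnC.
rewrite (mulrC (f b)); congr (_ * h (vsub a _)).
by apply/ffunP => i; rewrite !ffunE addnC.
Qed.

Definition euler f : series I := fun a => (wt a)%:R * f a.

Lemma euler_mul f g a :
  euler (series_mul f g) a = series_mul (euler f) g a + series_mul f (euler g) a.
Proof.
have aN := mem_box_wt (leqnn (wt a)).
rewrite /euler !(series_mulE _ _ aN) mulr_sumr -big_split; apply: eq_bigr => b ba /=.
by rewrite (wt_sub ba) natrD mulrDl mulrA mulrCA.
Qed.

Lemma series1E a : series1 a = (a == zero)%:R.
Proof.
rewrite /series1; congr (nat_of_bool _)%:R.
apply/forallP/eqP => [H|-> i]; last by rewrite ffunE.
by apply/ffunP => i; rewrite ffunE; apply/eqP.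
Qed.

Lemma euler1 a : euler (@series1 I) a = 0.
Proof. by rewrite /euler series1E; case: eqP => [->|]; rewrite ?wt0 ?mul0r ?mulr0. Qed.

Lemma series_mulZr (x : Qt) f g a : series_mul f (fun b => x * g b) a = x * series_mul f g a.
Proof.
have aN := mem_box_wt (leqnn (wt a)).
rewrite !(series_mulE _ _ aN) mulr_sumr; apply: eq_bigr => b _.
by rewrite mulrCA.
Qed.

Lemma series_mul_eq f g g' a : g =1 g' -> series_mul f g a = series_mul f g' a.
Proof. by move=> /funext->. Qed.

Lemma euler_pow f k a : euler (series_pow f k.+1) a =
  k.+1%:R * series_mul (euler f) (series_pow f k) a.
Proof.
elim: k a => [|k IHk] a.
  rewrite [LHS]euler_mul (series_mul_eq f a euler1) mul1r -[RHS]addr0; congr (_ + _).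
  have aN := mem_box_wt (leqnn (wt a)).
  by rewrite (series_mulE _ _ aN) big1 // => b _; rewrite mulr0.
rewrite [LHS]euler_mul (series_mul_eq f a IHk) series_mulZr series_mulCA.
by rewrite -[k.+2]addn1 natrD mulrDl mul1r addrC.
Qed.

Lemma series_pow_eq0 f k a : f zero = 0 -> (wt a < k)%N -> series_pow f k a = 0.
Proof.
move=> f0; elim: k a => // k IHk a ak; have aN := mem_box_wt (leqnn (wt a)).
rewrite -[LHS]/(series_mul f (series_pow f k) a) (series_mulE _ _ aN) big1 // => b ba.
have [->|b0] := eqVneq b zero; first by rewrite f0 mul0r.
rewrite IHk ?mulr0 //; rewrite (wt_sub ba) ltnS in ak.
by apply: leq_trans ak; rewrite -[X in (X < _)%N]add0n ltn_add2r lt0n wt_eq0.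
Qed.

Lemma series_expE N f a : f zero = 0 -> (wt a <= N)%N ->
  series_exp f a = \sum_(k < N.+1) (k`!%:R)^-1 * series_pow f k a.
Proof.
move=> f0 aN; rewrite /series_exp.
rewrite -[RHS](big_mkord xpredT (fun k => (k`!%:R)^-1 * series_pow f k a)).
rewrite /index_iota subn0.
rewrite (fsbigE (iota 0 N.+1)) ?iota_uniq //; first by apply: eq_bigl => k; rewrite in_setT.
move=> k _; rewrite mem_iota /= add0n -leqNgt => Nk.
by rewrite series_pow_eq0 ?mulr0 //; apply: leq_ltn_trans Nk.
Qed.

Lemma series_exp0 f : f zero = 0 -> series_exp f zero = 1.
Proof.
move=> f0; rewrite (@series_expE 0) ?wt0 // big_ord1 fact0 invr1 mul1r.
by rewrite [LHS]series1E eqxx.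
Qed.

Lemma euler_exp N f a : f zero = 0 -> (wt a <= N)%N -> (wt a)%:R * series_exp f a =
  \sum_(b <- box I N | vle b a) euler f b * series_exp f (vsub a b).
Proof.
move=> f0 aN; have aB := mem_box_wt aN.
rewrite (series_expE f0 aN) mulr_sumr big_ord_recl /=.
rewrite mulrCA -[X in _ * X]/(euler (@series1 I) a) euler1 mulr0 add0r.
transitivity (\sum_(k < N) (k`!%:R)^-1 * series_mul (euler f) (series_pow f k) a).
  apply: eq_bigr => k _.
  rewrite mulrCA -[X in _ * X]/(euler (series_pow f k.+1) a) euler_pow mulrA; congr (_ * _).
  rewrite /bump add1n factS natrM invfM mulrAC mulVf ?mul1r //.
  by rewrite natr_Qt_eq0.
transitivity (\sum_(k < N) \sum_(b <- box I N | vle b a)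
    euler f b * ((k`!%:R)^-1 * series_pow f k (vsub a b))).
  apply: eq_bigr => k _; rewrite (series_mulE _ _ aB) mulr_sumr.
  by apply: eq_bigr => b _; rewrite mulrCA.
rewrite exchange_big /=; apply: eq_bigr => b ba.
(* The Euler operator has lowered the truncation to k < N. This still computes the exponential at a
   - b, of weight below N, unless |b| = 0, when the factor |b| kills the term. *)
have [wb|wb] := eqVneq (wt b) 0%N.
  by rewrite /euler wb !mul0r big1 // => k _; rewrite mul0r.
rewrite -mulr_sumr; congr (_ * _).
have : (wt b + wt (vsub a b) <= N)%N by rewrite -wt_sub.
case: N {aN aB} => [|N] leN; first by move: leN wb; rewrite leqn0 addn_eq0 => /andP[->].
apply/esym/series_expE => //; rewrite -ltnS; apply: leq_trans leN.
by rewrite -add1n leq_add2r lt0n.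
Qed.

(** * The recursion for the coefficients of Exp *)

Section PlethysticExp.
Variable c : vec -> {poly int}.
Hypothesis c0 : c zero = 0.

Let f : series I := fun b => Qt_of_intpoly (c b).
Let plog : series I := fun a =>
  \sum_(n \in [set n : nat | (0 < n)%N]%classic) (n%:R)^-1 * adams n f a.

Lemma adams_eq0 n a : (wt a < n)%N -> adams n f a = 0.
Proof.
move=> an; rewrite /adams; case: ifP => // /forallP na.
have -> : [ffun i => a i %/ n]%N = zero.
  by apply/ffunP => i; rewrite !ffunE divn_small // (leq_ltn_trans (leq_wt a i)).
by rewrite /f c0 Qt_adams_intpoly ?comp_poly0 ?rmorph0 // (leq_ltn_trans _ an).
Qed.

Lemma plogE N a : (wt a <= N)%N ->
  plog a = \sum_(n <- iota 0 N) (n.+1%:R)^-1 * adams n.+1 f a.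
Proof.
move=> aN; rewrite -(big_map S xpredT (fun n => (n%:R)^-1 * adams n f a)).
have -> : map S (iota 0 N) = iota 1 N by rewrite -(iotaDl 1 0).
rewrite /plog (fsbigE (iota 1 N)) ?iota_uniq //.
- rewrite big_seq_cond [RHS]big_seq; apply: eq_bigl => n.
  by rewrite andb_idr // mem_iota inE => /andP[].
- by move=> n /=; rewrite mem_iota => /andP[].
move=> n /= n0; rewrite mem_iota n0 /= add1n ltnS -ltnNge => Nn.
by rewrite adams_eq0 ?mulr0 // (leq_ltn_trans aN).
Qed.

Lemma plog0 : plog zero = 0.
Proof. by rewrite (@plogE 0) ?wt0 // big_nil. Qed.

(** At a = (n + 1) b the weight |a| = (n + 1) |b| cancels the denominator n + 1 of the plethystic
    sum. *)
Lemma euler_plog N a : (wt a <= N)%N -> euler plog a =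
  \sum_(n <- iota 0 N) \sum_(b <- box I N | vscale n.+1 b == a)
    (wt b)%:R * Qt_of_intpoly (c b \Po 'X^(n.+1)).
Proof.
move=> aN; rewrite /euler (plogE aN) mulr_sumr; apply: eq_bigr => n _.
rewrite /adams; case: ifP => [/forallP na|nna]; last first.
  rewrite !mulr0 big1 // => b /eqP Eb; case/negP: (negbT nna); apply/forallP => i.
  by rewrite -Eb ffunE dvdn_mulr.
set b := finfun _.
have Eb : vscale n.+1 b = a by apply/ffunP => i; rewrite !ffunE mulnC divnK.
rewrite (eq_bigl (fun u => true && (u == b))) => [|u /=]; last first.
  apply/eqP/eqP => [Eu|->//]; apply/ffunP => i.
  by rewrite ffunE -Eu ffunE mulKn.
rewrite big_box_pred1 //; last first.
  by apply: mem_box_wt; apply: leq_trans aN; rewrite -Eb wt_scale leq_pmull.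
rewrite -{1}Eb wt_scale natrM Qt_adams_intpoly // [n.+1%:R * _]mulrC.
by rewrite mulrA mulfK // natr_Qt_eq0.
Qed.

Lemma plethystic_Exp_zero : plethystic_Exp f zero = 1.
Proof. exact: series_exp0 plog0. Qed.

Definition plethystic_rec N (h : series I) a :=
  \sum_(n <- iota 0 N) \sum_(b <- box I N | vle (vscale n.+1 b) a)
    (wt b)%:R * Qt_of_intpoly (c b \Po 'X^(n.+1)) * h (vsub a (vscale n.+1 b)).

Lemma plethystic_Exp_rec N a : (wt a <= N)%N ->
  (wt a)%:R * plethystic_Exp f a = plethystic_rec N (plethystic_Exp f) a.
Proof.
move=> aN; rewrite [LHS](euler_exp plog0 aN) -/(plethystic_Exp f).
transitivity (\sum_(a' <- box I N | vle a' a) \sum_(n <- iota 0 N)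
  \sum_(b <- box I N | vscale n.+1 b == a')
    (wt b)%:R * Qt_of_intpoly (c b \Po 'X^(n.+1)) * plethystic_Exp f (vsub a a')).
  apply: eq_bigr => a' a'a; rewrite (@euler_plog N); last exact: leq_trans (vle_wt a'a) aN.
  by rewrite mulr_suml; apply: eq_bigr => n _; rewrite mulr_suml.
rewrite exchange_big; apply: eq_bigr => n _ /=.
rewrite (exchange_big_dep (fun b => vle (vscale n.+1 b) a)) /= => [|a' b a'a /eqP->//].
apply: eq_bigr => b ba.
rewrite (eq_bigl (fun a' => vle a' a && (a' == vscale n.+1 b))) => [|a']; last first.
  by rewrite eq_sym.
rewrite big_box_pred1 //; apply: vle_box ba (mem_box_wt aN).
Qed.

(** For a nonzero, |a| is invertible in Q(t), and every term with |b| > 0 involves h only at smaller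
    weight. *)
Lemma plethystic_Exp_unique h : h zero = 1 ->
  (forall a, (wt a)%:R * h a = plethystic_rec (wt a) h a) -> h = plethystic_Exp f.
Proof.
move=> h0 hrec; apply/funext => a.
have [n] := ubnP (wt a); elim: n a => // n IHn a an.
have [->|a0] := eqVneq a zero; first by rewrite h0 plethystic_Exp_zero.
have wa : (wt a)%:R != 0 :> Qt by rewrite natr_Qt_eq0 wt_eq0.
apply: (mulfI wa); rewrite hrec (plethystic_Exp_rec (leqnn _)).
apply: eq_bigr => k _; apply: eq_bigr => b ba.
have [wb|wb] := posnP (wt b); first by rewrite wb !mul0r.
congr (_ * _); apply: IHn; rewrite -ltnS; apply: leq_trans an.
rewrite ltnS [X in (_ < X)%N](wt_sub ba) -[X in (X < _)%N]add0n ltn_add2r.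
by rewrite wt_scale muln_gt0.
Qed.

End PlethysticExp.

Definition pExp (c : vec -> {poly int}) : series I :=
  plethystic_Exp (fun b => Qt_of_intpoly (c b)).

Definition integral (f : series I) := forall a, exists p, f a = Qt_of_intpoly p.

(** Used to replace c by a finitely supported family when a single coefficient is studied. *)
Lemma pExp_local c c' a : c zero = 0 -> c' zero = 0 ->
  (forall b, vle b a -> c b = c' b) -> pExp c a = pExp c' a.
Proof.
move=> c0 c'0; have [n] := ubnP (wt a); elim: n a => // n IHn a an cc'.
have [->|a0] := eqVneq a zero; first by rewrite /pExp !plethystic_Exp_zero.
have wa : (wt a)%:R != 0 :> Qt by rewrite natr_Qt_eq0 wt_eq0.
apply: (mulfI wa); rewrite /pExp !(plethystic_Exp_rec _ (leqnn _)) //.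
apply: eq_bigr => k _; apply: eq_bigr => b ba.
have [wb|wb] := posnP (wt b); first by rewrite wb !mul0r.
have le_ba : vle b a.
  by apply/vleP => i; apply: leq_trans (vleP _ _ ba i); rewrite ffunE leq_pmull.
rewrite cc' //; congr (_ * _); apply: IHn => [|b' b'a].
  rewrite -ltnS; apply: leq_trans an.
  rewrite ltnS [X in (_ < X)%N](wt_sub ba) -[X in (X < _)%N]add0n ltn_add2r.
  by rewrite wt_scale muln_gt0.
apply: cc'; apply/vleP => i; apply: leq_trans (vleP _ _ b'a i) _.
by rewrite ffunE leq_subr.
Qed.

(** * Changing the exponent by one monomial *)

Section Monomial.
Variables (b0 : vec) (k : nat).
Hypothesis b0_gt0 : (0 < wt b0)%N.

Definition bump_at (c : vec -> {poly int}) (p : {poly int}) : vec -> {poly int} :=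
  fun b => c b + (if b == b0 then p else 0).

Lemma bump_at0 c p : c zero = 0 -> bump_at c p zero = 0.
Proof.
rewrite /bump_at => ->; case: eqP => [E|]; last by rewrite addr0.
by have := b0_gt0; rewrite -E wt0.
Qed.

(** Multiplication by y^(n b0). *)
Definition shift n (f : series I) : series I :=
  fun a => if vle (vscale n b0) a then f (vsub a (vscale n b0)) else 0.

Lemma shiftD m n f a : shift m (shift n f) a = shift (n + m) f a.
Proof.
rewrite /shift vscaleDl -vle_vsub vsubA.
by do 2![case: ifP => //=].
Qed.

Lemma plethystic_rec_shift c N n f a :
  plethystic_rec c N (shift n f) a = shift n (plethystic_rec c N f) a.
Proof.
rewrite /plethystic_rec /shift; have [na|na] := boolP (vle (vscale n b0) a).
  apply: eq_bigr => m _; rewrite big_mkcond [RHS]big_mkcond; apply: eq_bigr => b _.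
  have := vle_vsub (vscale m.+1 b) (vscale n b0) a; rewrite na /= => ->.
  rewrite vaddC -vle_vsub; case: ifP => //= _; case: ifP => _; last by rewrite mulr0.
  by rewrite !vsubA vaddC.
rewrite big1 // => m _; rewrite big1 // => b ba; case: ifP => nb; last by rewrite mulr0.
have := vle_vsub (vscale n b0) (vscale m.+1 b) a.
by rewrite ba nb vaddC -vle_vsub (negPf na).
Qed.

Lemma plethystic_recB c N f g (x : Qt) a :
  plethystic_rec c N (fun u => f u - x * g u) a =
  plethystic_rec c N f a - x * plethystic_rec c N g a.
Proof.
rewrite /plethystic_rec mulr_sumr -sumrB; apply: eq_bigr => n _.
by rewrite mulr_sumr -sumrB; apply: eq_bigr => b _; rewrite mulrBr mulrCA.
Qed.

Lemma plethystic_rec_bump c p N f a : (wt a <= N)%N ->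
  plethystic_rec (bump_at c p) N f a = plethystic_rec c N f a +
    \sum_(n <- iota 0 N) (wt b0)%:R * Qt_of_intpoly (p \Po 'X^(n.+1)) * shift n.+1 f a.
Proof.
move=> aN; rewrite /plethystic_rec -big_split; apply: eq_bigr => n _ /=.
pose F b := if b == b0 then
  (wt b)%:R * Qt_of_intpoly (p \Po 'X^(n.+1)) * f (vsub a (vscale n.+1 b)) else 0.
transitivity (\sum_(b <- box I N | vle (vscale n.+1 b) a)
   ((wt b)%:R * Qt_of_intpoly (c b \Po 'X^(n.+1)) * f (vsub a (vscale n.+1 b)) + F b)).
  apply: eq_bigr => b _; rewrite /F /bump_at comp_polyD rmorphD mulrDr mulrDl.
  by case: eqP => // _; rewrite comp_poly0 rmorph0 mulr0 mul0r.
rewrite big_split /=; congr (_ + _); rewrite /F /shift -big_mkcondr.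
case: ifP => ba.
  rewrite big_box_pred1 //; apply: vle_box (mem_box_wt aN).
  by apply/vleP => i; apply: leq_trans (vleP _ _ ba i); rewrite ffunE leq_pmull.
rewrite mulr0 big1 // => b /andP[+ /eqP E].
by rewrite E ba.
Qed.

(* Exp(f - t^k y^b0) = (1 - t^k y^b0) Exp(f) *)
Lemma pExp_monomial c : c zero = 0 -> pExp (bump_at c (- 'X^k)) =
  fun a => pExp c a - Qt_of_intpoly 'X^k * shift 1 (pExp c) a.
Proof.
move=> c0; set E := pExp c; set tk := Qt_of_intpoly 'X^k.
have scale1 : vscale 1 b0 = b0 by apply/ffunP => i; rewrite ffunE mul1n.
have E0 : shift 1 E zero = 0.
  rewrite /shift scale1; case: ifP => // /vle_wt.
  by rewrite wt0 leqn0 => /eqP w0; have := b0_gt0; rewrite w0.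
apply/esym/plethystic_Exp_unique => [||a]; first exact: bump_at0.
  by rewrite E0 mulr0 subr0; apply: plethystic_Exp_zero.
set N := wt a; rewrite plethystic_rec_bump // plethystic_recB plethystic_rec_shift.
rewrite mulrBr /E (plethystic_Exp_rec c0 (leqnn _)) -/(pExp c) -/E -addrA -/N.
congr (_ + _).
have -> : shift 1 (plethystic_rec c N E) a = (wt (vsub a b0))%:R * shift 1 E a.
  rewrite /shift scale1; case: ifP => ba; last by rewrite mulr0.
  by rewrite [RHS](plethystic_Exp_rec c0 (N := N)) // /N (wt_sub ba) leq_addl.
have tkE n : Qt_of_intpoly (- 'X^k \Po 'X^(n.+1)) = - tk ^+ n.+1.
  by rewrite raddfN rmorphN /= comp_Xn_poly -!exprM mulnC exprM rmorphXn.
have -> : \sum_(n <- iota 0 N) (wt b0)%:R * Qt_of_intpoly (- 'X^k \Po 'X^(n.+1)) *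
    shift n.+1 (fun u => E u - tk * shift 1 E u) a =
  - (wt b0)%:R * (tk * shift 1 E a).
  (* The contribution of -t^k y^b0 to the recursion telescopes against the factor 1 - t^k y^b0. Only
     the first term remains: the last carries y^((N + 1) b0), of weight larger than N = |a|. *)
  transitivity (\sum_(0 <= n < N) ((wt b0)%:R * (tk ^+ n.+2 * shift n.+2 E a) -
     (wt b0)%:R * (tk ^+ n.+1 * shift n.+1 E a))).
    rewrite /index_iota subn0; apply: eq_bigr => n _; rewrite tkE.
    have -> : shift n.+1 (fun u => E u - tk * shift 1 E u) a =
      shift n.+1 E a - tk * shift n.+2 E a.
      rewrite -[n.+2]add1n -shiftD /shift; case: ifP => _; rewrite ?mulr0 ?subr0 //.
    rewrite mulrN mulNr -mulrA -!mulrBr -mulrN; congr (_ * _).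
    by rewrite mulrBr opprB mulrA -exprSr.
  rewrite telescope_sumr // expr1 mulNr.
  have -> : shift N.+1 E a = 0.
    rewrite /shift; case: ifP => // /vle_wt; rewrite wt_scale leqNgt.
    by rewrite (leq_trans _ (leq_pmulr _ b0_gt0)).
  by rewrite !mulr0 sub0r.
have [ba|/negbTE ba] := boolP (vle b0 a); last first.
  by rewrite /shift scale1 ba !(mulr0, oppr0, addr0).
rewrite {1}/N (wt_sub ba) natrD mulNr -opprD; congr (- _).
by rewrite mulrDl addrC mulrCA [_ * (tk * _)]mulrCA.
Qed.

End Monomial.
Lemma vsub_wt_lt a b : (0 < wt b)%N -> vle b a -> (wt (vsub a b) < wt a)%N.
Proof. by move=> b0 ba; rewrite (wt_sub ba) -[X in (X < _)%N]add0n ltn_add2r. Qed.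

(** * Integrality of the coefficients of Exp *)

Section Integrality.
Variable b0 : vec.
Hypothesis b0_gt0 : (0 < wt b0)%N.

Let stable p := forall c, c zero = 0 -> integral (pExp c) ->
  integral (pExp (bump_at b0 c p)).

Lemma bump_atD c p q : bump_at b0 (bump_at b0 c p) q = bump_at b0 c (p + q).
Proof.
by apply/funext => b; rewrite /bump_at; case: eqP => _; rewrite ?addr0 // addrA.
Qed.

Lemma bump_at_zero c : bump_at b0 c 0 = c.
Proof. by apply/funext => b; rewrite /bump_at if_same addr0. Qed.

Lemma stableD p q : stable p -> stable q -> stable (p + q).
Proof.
move=> sp sq c c0 ic; rewrite -bump_atD; apply: sq; first exact: bump_at0.
exact: sp.
Qed.

Lemma stable_oppX k : stable (- 'X^k).
Proof.
move=> c c0 ic a; rewrite pExp_monomial //.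
have [p ->] := ic a.
have [q ->] : exists q, shift b0 1 (pExp c) a = Qt_of_intpoly q.
  by rewrite /shift; case: ifP => _; [apply: ic | exists 0; rewrite rmorph0].
by exists (p - 'X^k * q); rewrite rmorphB rmorphM.
Qed.

(** Removing the monomial again gives E' = E + t^k y^b0 E', which determines E' integrally by
    induction on the weight. *)
Lemma stableX k : stable 'X^k.
Proof.
move=> c c0 ic; set c' := bump_at b0 c _ => a.
have c'0 : c' zero = 0 by apply: bump_at0.
have E u : pExp c' u = pExp c u + Qt_of_intpoly 'X^k * shift b0 1 (pExp c') u.
  have := pExp_monomial k b0_gt0 c'0; rewrite {1}/c' bump_atD subrr bump_at_zero.
  by move/(congr1 (@^~ u)) => /= ->; rewrite subrK.
have [n] := ubnP (wt a); elim: n a => // n IHn a an; rewrite E.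
have [p ->] := ic a.
have [q ->] : exists q, shift b0 1 (pExp c') a = Qt_of_intpoly q.
  rewrite /shift; case: ifP => ba; last by exists 0; rewrite rmorph0.
  apply: IHn; rewrite -ltnS; apply: leq_trans an; rewrite ltnS.
  by apply: vsub_wt_lt => //; rewrite wt_scale mul1n.
by exists (p + 'X^k * q); rewrite rmorphD rmorphM.
Qed.

(** p is a finite sum of terms t^k and -t^k because its coefficients are integers. *)
Lemma stable_poly p : stable p.
Proof.
have stable0 : stable 0 by move=> c _ ic; rewrite bump_at_zero.
have stableMn q n : stable q -> stable (q *+ n).
  move=> sq; elim: n => [|n IHn]; first by rewrite mulr0n.
  by rewrite mulrS; apply: stableD.
rewrite -[p]coefK poly_def; elim/big_rec: _ => // i q _ sq; apply: stableD => //.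
rewrite -mul_polyC; have -> : (p`_i)%:P = (p`_i)%:~R :> {poly int}.
  by rewrite -[in LHS](intz p`_i) rmorph_int.
rewrite mulrzl; case: (p`_i) => n.
  exact/stableMn/stableX.
by rewrite NegzE mulrNz -mulNrz; apply/stableMn/stable_oppX.
Qed.

End Integrality.

(** By [pExp_local] only the coefficients of c in a box matter; they are added one at a time,
    starting from Exp(0) = 1. *)
Lemma pExp_integral c : c zero = 0 -> integral (pExp c).
Proof.
move=> c0 a; pose cs (s : seq vec) b := if b \in s then c b else 0.
have cs0 s : cs s zero = 0 by rewrite /cs c0 if_same.
suff H s : integral (pExp (cs s)).
  have [p Ep] := H (box I (wt a)) a; exists p; rewrite -Ep.
  apply: pExp_local => // b ba; rewrite /cs (vle_box ba) //.
  exact: mem_box_wt.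
elim: s => [|b s IHs].
  move=> u; exists (u == zero)%:R; rewrite rmorph_nat -series1E.
  rewrite -[RHS]/((@series1 I) u); congr (_ u); apply/esym/plethystic_Exp_unique => //.
    by rewrite series1E eqxx.
  move=> v; rewrite -[LHS]/(euler _ v) euler1 /plethystic_rec big1 // => n _.
  by rewrite big1 // => w _; rewrite /cs in_nil comp_poly0 rmorph0 mulr0 mul0r.
have [bs|bs] := boolP (b \in s).
  have -> // : cs (b :: s) = cs s.
  by apply/funext => u; rewrite /cs inE; case: eqP => [->|] //=; rewrite bs.
have [b0|b_gt0] := posnP (wt b).
  have -> // : cs (b :: s) = cs s.
  apply/funext => u; rewrite /cs inE; case: eqP => [->|] //=.
  have -> : b = zero by apply/eqP; rewrite -wt_eq0 b0.
  by rewrite c0 if_same.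
have -> : cs (b :: s) = bump_at b (cs s) (c b).
  apply/funext => u; rewrite /cs /bump_at inE; case: eqP => [->|] /=.
    by rewrite (negPf bs) add0r.
  by rewrite addr0.
exact: stable_poly.
Qed.

End Series.

(** * Conclusion *)

(** Prime fields suffice: [size p] distinct primes would be one root more than the degree of a
    nonzero p allows. *)
Lemma poly_eq0_of_card (p : {poly int}) :
  (forall F : finFieldType, p.[#|F|%:R] = 0) -> p = 0.
Proof.
move=> H; apply: contrapT => /eqP p0.
have [s [us sz_s pr_s]] : exists s : seq nat,
    [/\ uniq s, size s = size p & all prime s].
  elim: (size p) => [|n [s [us <- pr_s]]]; first by exists [::].
  have [q q_gt q_pr] := prime_above (\max_(i <- s) i).
  exists (q :: s); split=> //=; last by rewrite q_pr.
  by rewrite us andbT; apply/negP => qs; rewrite ltnNge leq_bigmax_seq in q_gt.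
have := @max_poly_roots _ p [seq (q%:R : int) | q <- s] p0.
rewrite size_map sz_s ltnn => E; suff : false by []. apply: E.
  apply/allP => _ /mapP[q qs ->]; rewrite rootE.
  by rewrite -{1}(card_Fp (allP pr_s q qs)) H.
by rewrite map_inj_uniq // => q r /eqP; rewrite Num.Theory.eqr_nat => /eqP.
Qed.

Lemma num_iso_classes_none (Q : quiver) (F : finFieldType) (d : vertex Q -> nat)
    (P : rep F d -> Prop) : (forall X, ~ P X) -> num_iso_classes P = 0%N.
Proof.
move=> nP; rewrite /num_iso_classes /equivalence_partition.
have -> : finset (fun X => `[< P X >]) = finset.set0.
  by apply/setP => X; rewrite !inE; apply/asboolP/nP.
by rewrite imset0 cards0.
Qed.

(** The zero representation has no indecomposable summand, so it has level at most any V, even the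
    empty one. *)
Lemma num_level_zero (Q : quiver) (F : finFieldType) (V : set (dimvec Q)) :
  num_iso_classes (fun X : rep F (vzero (vertex Q)) => level_at_most V X) = 1%N.
Proof.
have zero0 i : vzero (vertex Q) i = 0%N by rewrite ffunE.
apply: (@num_iso_classes_size _ _ _ _ unit (fun=> tt) [:: tt]) => // [X Y|[]].
  by split=> // _; apply: iso_zero.
split=> // _; exists [ffun h => 0]; split=> // b [Y [[[i bi] _] [d' [Z XYZ]]]].
case: bi; have := congr1 (@^~ i) (iso_dim XYZ); rewrite zero0 => /esym/eqP.
by rewrite addn_eq0 => /andP[/eqP].
Qed.

Theorem lemma3p1p10 (Q : quiver) (a : dimvec Q -> {poly int})
    (a_kac : forall beta : dimvec Q, is_kac_polynomial beta (a beta))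
    (V : set (dimvec Q)) :
  exists M : dimvec Q -> {poly int},
    (forall (alpha : dimvec Q) (F : finFieldType),
       (M alpha).[#|F|%:R] =
         (num_iso_classes (fun X : rep F alpha => level_at_most V X))%:R) /\
    plethystic_Exp
      (fun beta : dimvec Q =>
         if `[< V beta >] then Qt_of_intpoly (a beta) else 0) =
    (fun alpha : dimvec Q => Qt_of_intpoly (M alpha)).
Proof.
pose c (b : dimvec Q) := if `[< V b >] then a b else 0.
(* Exp needs a vanishing constant term even when 0 is in V; the zero representation is not
   indecomposable, so a_0 vanishes at all q. *)
have c0 : c (vzero (vertex Q)) = 0.
  rewrite /c; case: ifP => // _; apply: poly_eq0_of_card => F.
  rewrite a_kac num_iso_classes_none // => X [[i]].
  by rewrite ffunE.
(* M is defined by the coefficients of Exp, so the generating identity is immediate and the values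
   at q remain to be computed. *)
have [M EM] : exists M : dimvec Q -> {poly int},
    forall alpha, pExp c alpha = Qt_of_intpoly (M alpha).
  exists (fun alpha => projT1 (cid (pExp_integral c0 alpha))) => alpha.
  by case: cid.
exists M; split; last first.
  have -> : (fun beta => if `[< V beta >] then Qt_of_intpoly (a beta) else 0) =
            (fun beta => Qt_of_intpoly (c beta)).
    by apply/funext => beta; rewrite /c; case: ifP => // _; rewrite rmorph0.
  by apply/funext => alpha; apply: EM.
have M0 : M (vzero (vertex Q)) = 1.
  by apply: Qt_of_intpoly_inj; rewrite -EM rmorph1; apply: plethystic_Exp_zero.
(* The recursion is pulled back from Q(t) to Z[t], where it can be evaluated at q. *)
have recM alpha : (wt alpha)%:R * M alpha = \sum_(n <- iota 0 (wt alpha))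
    \sum_(b <- box (vertex Q) (wt alpha) | vle (vscale n.+1 b) alpha)
      (wt b)%:R * (c b \Po 'X^(n.+1)) * M (vsub alpha (vscale n.+1 b)).
  apply: Qt_of_intpoly_inj; rewrite rmorphM rmorph_nat /= -EM.
  rewrite [LHS](plethystic_Exp_rec c0 (leqnn _)) rmorph_sum; apply: eq_bigr => n _.
  rewrite rmorph_sum; apply: eq_bigr => b _.
  by rewrite !rmorphM rmorph_nat /= -EM.
move=> alpha F; have [n] := ubnP (wt alpha); elim: n alpha => // n IHn alpha lt_n.
have [->|alpha0] := eqVneq alpha (vzero (vertex Q)).
  by rewrite M0 hornerC num_level_zero.
have walpha : (wt alpha)%:R != 0 :> int by rewrite Num.Theory.pnatr_eq0 wt_eq0.
apply: (mulfI walpha).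
have := congr1 (horner^~ (#|F|%:R : int)) (recM alpha).
rewrite hornerM -[X in X.[_] * _]polyC_natr hornerC => ->.
rewrite -natrM (num_iso_classes_recursion F V (leqnn _)) natr_sum horner_sum.
apply: eq_bigr => m _; rewrite natr_sum horner_sum big_mkcondl /=.
apply: eq_bigr => b ba; rewrite /c; case: asboolP => Vb; last first.
  by rewrite comp_poly0 mulr0 mul0r horner0.
rewrite !hornerM -[X in X.[_] * _ * _]polyC_natr hornerC horner_comp hornerXn -natrX.
(* For |b| = 0 the vector alpha - (m + 1) b is alpha itself, out of reach of the induction, but the
   term has factor 0. *)
have [wb|wb] := posnP (wt b); first by rewrite wb mul0n !mul0r.
rewrite IHn; last first.
  rewrite -ltnS; apply: leq_trans lt_n; rewrite ltnS; apply: vsub_wt_lt => //.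
  by rewrite wt_scale muln_gt0.
(* Evaluating a_b(t^(m + 1)) at q gives a_b(q^(m + 1)), which counts over the subfield of K with
   q^(m + 1) elements. *)
have := a_kac b (subfield (to_algclosure F) m); rewrite card_subfield => ->.
by rewrite !natrM mulrA.
Qed.
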